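(* Let $(a_k)_{k\geq 0}$ be Sylvester's sequence, $a_0=2$ and $a_{k+1}=1+\prod_{i=0}^{k}a_i$ for $k\geq 0$. Let $R$ be a fusion ring and let $n\geq 1$ be an integer. If the formal codegrees of $R$ include $a_0,a_1,\ldots,a_{n-1}$, then $R$ contains a fusion subring isomorphic to the greedy fusion ring $R_n$.
   Context: **Fusion rings.** A fusion ring is an associative ring $R$ with identity $1_R$, free of finite rank as an abelian group, with a distinguished finite $\mathbb{Z}$-basis $B\ni 1_R$ such that for $b_j,b_k\in B$, $b_jb_k=\sum_\ell c_{j,k}^\ell b_\ell$ with all $c_{j,k}^\ell\in\mathbb{Z}_{\geq 0}$, together with an involution $b\mapsto b^\ast$ of $B$ which extends linearly to an anti-involution of the ring $R$ and such that, for $b,b'\in B$, the coefficient of $1_R$ in $bb'$ is $1$ if $b'=b^\ast$ and $0$ otherwise. The rank of $R$ is $|B|$. A fusion subring of $R$ is the $\mathbb{Z}$-span of a subset $B'\subset B$ containing $1_R$ that is closed under multiplication and under duality $b\mapsto b^\ast$; it is a fusion ring with basis $B'$. Isomorphisms of fusion rings are ring isomorphisms that map distinguished basis bijectively to distinguished basis. **Formal codegrees.** For each irreducible complex representation $\varphi$ of $R\otimes_{\mathbb{Z}}\mathbb{C}$ (up to isomorphism), the element $\sum_{b\in B}\mathrm{Tr}(\varphi(b))\,b^\ast$ acts on $\varphi$ by a positive real scalar $f_\varphi$, called the formal codegree of $\varphi$. If $\varphi:R\to\mathbb{C}$ is a ring homomorphism (one-dimensional representation), then $f_\varphi=\sum_{b\in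 B}\varphi(b)\varphi(b^\ast)=\sum_{b\in B}|\varphi(b)|^2$. The formal codegrees of $R$ are the numbers $f_\varphi$ over all irreducible $\varphi$, each $f_\varphi$ counted with multiplicity $\dim(\varphi)$. Saying that the formal codegrees include given numbers means each of these numbers equals $f_\varphi$ for some irreducible $\varphi$. **Greedy fusion rings.** Put $d_0=1$ and $d_k=a_{k-1}-1$ for $k\geq 1$. For $n\geq 1$, the greedy fusion ring $R_n$ is the commutative fusion ring of rank $n+1$ with basis $r_0=1,r_1,\ldots,r_n$, trivial duality $r_k^\ast=r_k$, and products $$r_jr_k=r_kr_j=d_j\,r_k\quad(0\leq j<k\leq n),\qquad r_kr_k=(a_{k-1}-2)\,r_k+\sum_{j=0}^{k-1}d_j\,r_j\quad(1\leq k\leq n).$$ Here $d_k$ is the Frobenius-Perron dimension of $r_k$ (the Frobenius-Perron dimension is the unique ring homomorphism to $\mathbb{C}$ that is nonnegative on the basis). In particular $R_1\cong\mathbb{Z}C_2$, the integral group ring of the group of order $2$, and $R_1\subset R_2\subset\cdots\subset R_n$. *)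

(* Defs.v *)
From HB Require Import structures.
From mathcomp Require Import all_boot all_order all_algebra.
From mathcomp Require Import boolp reals.
From mathcomp Require Import complex ring zify.

Set Implicit Arguments.
Unset Strict Implicit.
Unset Printing Implicit Defensive.

Import Order.TTheory GRing.Theory Num.Theory.
Local Open Scope ring_scope.

Definition Zbasis (V : zmodType) (I : finType) (b : I -> V) : Prop :=
  forall x : V, exists! c : {ffun I -> int}, x = \sum_i b i *~ c i.

Definition Zcoord (V : zmodType) (I : finType) (b : I -> V) (bP : Zbasis b)
    (x : V) : {ffun I -> int} := sval (cid (bP x)).

(* The additive extension to V of a self-map s of the basis. *)
Definition Zlin_ext (V : zmodType) (I : finType) (b : I -> V) (bP : Zbasis b)
    (s : I -> I) (x : V) : V := \sum_i b (s i) *~ Zcoord bP x i.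

Lemma ZcoordP (V : zmodType) (I : finType) (b : I -> V) (bP : Zbasis b) x :
  x = \sum_i b i *~ Zcoord bP x i.
Proof. by rewrite /Zcoord; case: cid => c []. Qed.

Lemma Zcoord_eq (V : zmodType) (I : finType) (b : I -> V) (bP : Zbasis b)
    x (c : {ffun I -> int}) : x = \sum_i b i *~ c i -> Zcoord bP x = c.
Proof. by rewrite /Zcoord; case: cid => c' /= [_]; apply. Qed.

(* The distinguished basis is a family indexed by a finite type; duality is an
   involution of the index type. *)
Record fusionRing := FusionRing {
  fring :> nzRingType;
  fidx : finType;
  fbasis : fidx -> fring;
  fone : fidx;
  fdual : fidx -> fidx;
  fbasisP : Zbasis fbasis;
  fbasis1 : fbasis fone = 1;
  fcoef_ge0 : forall j k l, 0 <= Zcoord fbasisP (fbasis j * fbasis k) l;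
  fdualK : involutive fdual;
  fdualM : forall x y : fring, Zlin_ext fbasisP fdual (x * y) =
    Zlin_ext fbasisP fdual y * Zlin_ext fbasisP fdual x;
  fcoef1 : forall j k,
    Zcoord fbasisP (fbasis j * fbasis k) fone = (k == fdual j)%:R
}.

(* Representations of the complexification of R are given as unital ring
   morphisms from R to a complex matrix algebra acting on column vectors. *)
Definition irreducible_rep (K : realType) (R : fusionRing) (m : nat)
    (phi : {rmorphism R -> 'M[complex K]_m}) : Prop :=
  (0 < m)%N /\
  forall U : {vspace 'cV[complex K]_m},
    (forall (x : R) (v : 'cV[complex K]_m), v \in U -> phi x *m v \in U) ->
    U = 0%VS \/ U = fullv.

Definition formal_codegree_of (K : realType) (R : fusionRing) (m : nat)
    (phi : {rmorphism R -> 'M[complex K]_m}) (f : complex K) : Prop :=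
  \sum_(b : fidx R) \tr (phi (fbasis b)) *: phi (fbasis (fdual b)) = f%:M.

Definition formal_codegree (K : realType) (R : fusionRing) (f : complex K) :
    Prop :=
  exists (m : nat) (phi : {rmorphism R -> 'M[complex K]_m}),
    irreducible_rep phi /\ formal_codegree_of phi f.

Definition fspan (R : fusionRing) (B : {set fidx R}) : {pred R} :=
  fun x => `[< exists c : fidx R -> int, x = \sum_(i in B) fbasis i *~ c i >].

Record fusionSubring (R : fusionRing) := FusionSubring {
  fsub_set : {set fidx R};
  fsub1 : fone R \in fsub_set;
  fsubM : {in fspan fsub_set &, forall x y : R, x * y \in fspan fsub_set};
  fsub_dual : {in fsub_set, forall i, fdual i \in fsub_set}
}.

Definition fusion_isomorphic (R S : fusionRing) : Prop :=
  exists f : {rmorphism R -> S}, bijective f /\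
    exists s : fidx R -> fidx S,
      bijective s /\ forall i, f (fbasis i) = fbasis (s i).

Section SubringFusion.
Variables (R : fusionRing) (S : fusionSubring R).

Lemma fspanP (B : {set fidx R}) (x : R) : reflect
  (forall i, i \notin B -> Zcoord (fbasisP (f:=R)) x i = 0) (x \in fspan B).
Proof.
apply: (iffP idP).
  move=> /asboolP[c xE] i iB.
  rewrite (@Zcoord_eq _ _ _ _ _ [ffun i => if i \in B then c i else 0]).
    by rewrite ffunE (negbTE iB).
  rewrite xE big_mkcond; apply: eq_bigr => j _.
  by rewrite ffunE; case: ifP; rewrite ?mulr0z.
move=> h; apply/asboolP; exists (Zcoord (fbasisP (f:=R)) x).
rewrite {1}(ZcoordP (fbasisP (f:=R)) x) [RHS]big_mkcond; apply: eq_bigr => i _.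
by case: ifPn => // /h ->; rewrite mulr0z.
Qed.

Lemma fspan_basis (i : fidx R) (B : {set fidx R}) :
  i \in B -> fbasis i \in fspan B.
Proof.
move=> iB; apply/asboolP; exists (fun j => (j == i)%:R).
rewrite (bigD1 i) //= eqxx big1 ?addr0 // => j /andP[_ /negbTE ->].
by rewrite mulr0z.
Qed.

Lemma fspan_subring_closed : subring_closed (fspan (fsub_set S)).
Proof.
split.
- by rewrite -fbasis1; apply: fspan_basis; apply: fsub1.
- move=> x y /asboolP[c ->] /asboolP[d ->]; apply/asboolP.
  exists (fun i => c i - d i); rewrite -sumrB.
  by apply: eq_bigr => i _; rewrite mulrzBr.
- exact: fsubM.
Qed.

HB.instance Definition _ :=
  GRing.isSubringClosed.Build R (fspan (fsub_set S)) fspan_subring_closed.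

Record fsub_type := FsubType {
  fsub_val :> R;
  fsub_valP : fsub_val \in fspan (fsub_set S)
}.

HB.instance Definition _ := [isSub for fsub_val].
HB.instance Definition _ := [Choice of fsub_type by <:].
HB.instance Definition _ := [SubChoice_isSubNzRing of fsub_type by <:].

Definition fsub_idx : finType := {i : fidx R | i \in fsub_set S}.

Definition fsub_basis (i : fsub_idx) : fsub_type :=
  FsubType (fspan_basis (valP i)).

Definition fsub_one : fsub_idx := exist _ (fone R) (fsub1 S).

Definition fsub_dualf (i : fsub_idx) : fsub_idx :=
  exist _ (fdual (val i)) (fsub_dual (valP i)).

Lemma fsub_sumE (F : fidx R -> R) :
  \sum_(i : fsub_idx) F (val i) = \sum_(i in fsub_set S) F i.
Proof. by rewrite [RHS]big_sub. Qed.

Lemma fsub_valsum (c : fsub_idx -> int) :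
  fsub_val (\sum_i fsub_basis i *~ c i) =
  \sum_i fbasis (val i) *~ c i.
Proof.
rewrite -[LHS]/(val _) raddf_sum.
by apply: eq_bigr => i _; rewrite raddfMz.
Qed.

Lemma fsub_sum_ext (c : {ffun fsub_idx -> int}) (F : fidx R -> R) :
  \sum_i F (val i) *~ c i =
  \sum_i F i *~ [ffun i : fidx R => oapp c 0 (insub i)] i.
Proof.
rewrite (bigID [in fsub_set S]) /= [X in _ + X]big1 ?addr0; last first.
  by move=> i iS; rewrite ffunE insubF ?mulr0z //; apply: negbTE.
rewrite -(fsub_sumE (fun i => F i *~ _)); apply: eq_bigr => i _.
by rewrite ffunE valK.
Qed.

Lemma fsub_basisP : Zbasis fsub_basis.
Proof.
move=> x; pose c := Zcoord (fbasisP (f:=R)) (fsub_val x).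
exists [ffun i => c (val i)]; split.
  apply: val_inj; rewrite /= fsub_valsum.
  under eq_bigr do rewrite ffunE.
  rewrite (fsub_sumE (fun i => fbasis i *~ c i)) big_mkcond.
  rewrite {1}(ZcoordP (fbasisP (f:=R)) (fsub_val x)).
  apply: eq_bigr => i _; case: ifPn => // iS.
  by rewrite (fspanP _ _ (fsub_valP x)) // mulr0z.
move=> d xE; apply/ffunP => i; rewrite ffunE /c.
rewrite (@Zcoord_eq _ _ _ _ _ [ffun i : fidx R => oapp d 0 (insub i)]).
  by rewrite ffunE valK.
by rewrite {1}xE fsub_valsum fsub_sum_ext.
Qed.

Lemma fsub_coord (x : fsub_type) (i : fsub_idx) :
  Zcoord fsub_basisP x i = Zcoord (fbasisP (f:=R)) (fsub_val x) (val i).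
Proof.
rewrite (@Zcoord_eq _ _ _ _ (fsub_val x)
  [ffun i => oapp (Zcoord fsub_basisP x) 0 (insub i)]).
  by rewrite ffunE valK.
by rewrite {1}(ZcoordP fsub_basisP x) fsub_valsum fsub_sum_ext.
Qed.

Lemma fsub_dual_ext (x : fsub_type) :
  fsub_val (Zlin_ext fsub_basisP fsub_dualf x) =
  Zlin_ext (fbasisP (f:=R)) (@fdual R) (fsub_val x).
Proof.
rewrite /Zlin_ext -[LHS]/(val _) raddf_sum.
under eq_bigr do rewrite raddfMz /= fsub_coord.
pose F i := fbasis (fdual i) *~ Zcoord (fbasisP (f:=R)) (fsub_val x) i.
rewrite (fsub_sumE F) big_mkcond; apply: eq_bigr => i _.
case: ifPn => // iS.
by rewrite (fspanP _ _ (fsub_valP x)) // mulr0z.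
Qed.

Lemma fsub_coef_ge0 j k l :
  0 <= Zcoord fsub_basisP (fsub_basis j * fsub_basis k) l.
Proof. by rewrite fsub_coord /=; apply: fcoef_ge0. Qed.

Lemma fsub_dualK : involutive fsub_dualf.
Proof. by move=> i; apply: val_inj; rewrite /= fdualK. Qed.

Lemma fsub_dualM (x y : fsub_type) :
  Zlin_ext fsub_basisP fsub_dualf (x * y) =
  Zlin_ext fsub_basisP fsub_dualf y * Zlin_ext fsub_basisP fsub_dualf x.
Proof. by apply: val_inj; rewrite /= !fsub_dual_ext /= fdualM. Qed.

Lemma fsub_coef1 j k :
  Zcoord fsub_basisP (fsub_basis j * fsub_basis k) fsub_one =
  (k == fsub_dualf j)%:R.
Proof. by rewrite fsub_coord /= fcoef1. Qed.

Lemma fsub_basis1 : fsub_basis fsub_one = 1.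
Proof. by apply: val_inj; rewrite /= fbasis1. Qed.

Definition fusion_of_subring : fusionRing :=
  @FusionRing fsub_type fsub_idx fsub_basis fsub_one fsub_dualf fsub_basisP
    fsub_basis1 fsub_coef_ge0 fsub_dualK fsub_dualM fsub_coef1.

End SubringFusion.

(* sylvester_prod k is the product of the first k terms of the sequence. *)
Fixpoint sylvester_prod (k : nat) : nat :=
  if k is k'.+1 then (sylvester_prod k' * (sylvester_prod k').+1)%N else 1%N.

Definition sylvester (k : nat) : nat := (sylvester_prod k).+1.

Lemma sylvester0 : sylvester 0 = 2%N.
Proof. by []. Qed.

Lemma sylvesterS k :
  sylvester k.+1 = (1 + \prod_(i < k.+1) sylvester i)%N.
Proof.
rewrite add1n; congr _.+1; elim: k.+1 => [|j IH]; first by rewrite big_ord0.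
by rewrite big_ord_recr /= -IH.
Qed.

Definition greedy_dim (k : nat) : nat :=
  if k is k'.+1 then (sylvester k' - 1)%N else 1%N.

(* The coefficient of r_l in r_j r_k; the subtraction is exact since
   sylvester takes values at least 2. *)
Definition greedy_coef (j k l : nat) : nat :=
  if (j < k)%N then (greedy_dim j * (l == k))%N
  else if (k < j)%N then (greedy_dim k * (l == j))%N
  else if j is j'.+1 then
    ((sylvester j' - 2) * (l == j) + (if (l < j)%N then greedy_dim l else 0))%N
  else (l == 0)%N.

(* The value at r_j of the m-th character, for 1 <= m <= n + 1. These characters
   are jointly injective, which transfers the ring axioms from int. *)
Definition greedy_chi (m j : nat) : int :=
  if (j < m)%N then (greedy_dim j)%:R else if j == m then -1 else 0.

Lemma sylvester_prod_gt0 k : (0 < sylvester_prod k)%N.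
Proof. by elim: k => //= k IH; rewrite muln_gt0 IH. Qed.

Lemma greedy_dimS k : greedy_dim k.+1 = sylvester_prod k.
Proof. by rewrite /= /sylvester subn1. Qed.

Lemma greedy_dim_gt0 k : (0 < greedy_dim k)%N.
Proof. by case: k => // k; rewrite greedy_dimS sylvester_prod_gt0. Qed.

Lemma greedy_dimSS k : (0 < k)%N ->
  greedy_dim k.+1 = (greedy_dim k * (greedy_dim k).+1)%N.
Proof. by case: k => // k _; rewrite !greedy_dimS. Qed.

Lemma greedy_sum_chi m j : (0 < m)%N -> (0 < j)%N ->
  \sum_(l < j) (greedy_dim l)%:R * greedy_chi m l =
  if (j <= m)%N then (greedy_dim j)%:R else 0.
Proof.
move=> m0; case: j => // j _; elim: j => [|j IH].
  by rewrite big_ord1 /greedy_chi m0.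
rewrite big_ord_recr [LHS]/= IH /greedy_chi (@greedy_dimSS j.+1) // natrM -natr1.
by case: (ltngtP j.+1 m) => _; ring.
Qed.

Lemma greedy_sum_pick n (j c : nat) (F : nat -> int) : (j < n)%N ->
  \sum_(l < n) (c * (l == j :> nat))%N%:R * F l = c%:R * F j.
Proof.
move=> jn; rewrite (bigD1 (Ordinal jn)) //= eqxx muln1 big1 ?addr0 // => i ij.
by rewrite (negbTE (ij : val i != j)) muln0 mul0r.
Qed.

Lemma greedy_chi_lt m j k : (j < k)%N ->
  greedy_chi m j * greedy_chi m k = (greedy_dim j)%:R * greedy_chi m k.
Proof.
rewrite /greedy_chi => jk; case: (ltngtP k m) => [km|_|<-].
- by rewrite (ltn_trans jk km).
- by rewrite !mulr0.
- by rewrite jk.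
Qed.

Lemma greedy_coef_chi n m j k : (0 < m)%N -> (j < n)%N -> (k < n)%N ->
  \sum_(l < n) (greedy_coef j k l)%:R * greedy_chi m l = greedy_chi m j * greedy_chi m k.
Proof.
move=> m0 jn kn; rewrite /greedy_coef; case: (ltngtP j k) => [jk|kj|<-{k kn}].
- by rewrite greedy_sum_pick // greedy_chi_lt.
- by rewrite greedy_sum_pick // mulrC [RHS]mulrC greedy_chi_lt // mulrC.
- case: j jn => [|j] jn.
    have := @greedy_sum_pick n 0 1 (greedy_chi m) jn.
    by under eq_bigr do rewrite mul1n; move=> ->; rewrite /greedy_chi m0.
  under eq_bigr do rewrite natrD mulrDl.
  rewrite big_split /= greedy_sum_pick //.
  have -> : \sum_(i < n) (if (i < j.+1)%N then greedy_dim i else 0%N)%:R *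
      greedy_chi m i = \sum_(i < j.+1) (greedy_dim i)%:R * greedy_chi m i.
    rewrite (big_ord_widen n (fun i => (greedy_dim i)%:R * greedy_chi m i)) 1?ltnW //.
    rewrite [RHS]big_mkcond; apply: eq_bigr => i _.
    by case: ifP; rewrite ?mul0r.
  rewrite greedy_sum_chi // /greedy_chi greedy_dimS /sylvester.
  have := sylvester_prod_gt0 j; case: (sylvester_prod j) => // p _.
  rewrite !subSS subn0 -natr1.
  by case: (ltngtP j.+1 m) => _; ring.
Qed.

Definition greedy_Phi n (x : {ffun 'I_n -> int}) (m : nat) : int :=
  \sum_(i < n) x i * greedy_chi m i.

Lemma greedy_Phi_inj n (x y : {ffun 'I_n -> int}) :
  (forall m, (0 < m)%N -> greedy_Phi x m = greedy_Phi y m) -> x = y.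
Proof.
move=> h; pose z (i : nat) : int :=
  if insub i is Some u then x u - y u else 0.
pose T j : int := \sum_(l < j) (greedy_dim l)%:R * z l.
have h0 m : (0 < m)%N -> \sum_(i < n) z i * greedy_chi m i = 0.
  move=> /h /eqP; rewrite -subr_eq0 /greedy_Phi -sumrB => /eqP hm; rewrite -[RHS]hm.
  by apply: eq_bigr => i _; rewrite /z valK mulrBl.
have zn i : (n <= i)%N -> z i = 0 by move=> ni; rewrite /z insubF // ltnNge ni.
have TE m : (0 < m)%N -> T m = z m.
  move=> m0; apply/eqP; rewrite -subr_eq0; apply/eqP.
  have wide N : (n <= N)%N -> \sum_(i < n) z i * greedy_chi m i =
      \sum_(i < N) z i * greedy_chi m i.
    move=> nN; rewrite (big_ord_widen N (fun i => z i * greedy_chi m i)) //.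
    rewrite big_mkcond; apply: eq_bigr => i _; case: ltnP => // /zn ->.
    by rewrite mul0r.
  rewrite -(h0 m m0) (wide (m.+1 + n)%N) ?leq_addl //.
  rewrite big_split_ord /= [X in _ = _ + X]big1 ?addr0; last first.
    move=> i _; rewrite /greedy_chi [(_ < m)%N]ltn_geF ?gtn_eqF ?mulr0 //=; lia.
  rewrite big_ord_recr /= /greedy_chi ltnn eqxx mulrN1; congr (_ - _).
  by apply: eq_bigr => i _; rewrite ltn_ord mulrC.
have T0 k : (k <= n)%N -> T (n - k).+1 = 0.
  elim: k => [_|k IH kn]; first by rewrite subn0 TE // zn.
  move: (IH (ltnW kn)); rewrite -[(n - k)%N](@ltn_predK 0) ?subn_gt0 // -subnS.
  rewrite {1}/T big_ord_recr /= -/(T _) -TE //.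
  rewrite -{1}[T _]mul1r -mulrDl => /eqP; rewrite mulf_eq0 => /orP[|/eqP //].
  by rewrite nat1r pnatr_eq0.
apply/ffunP => i; apply/eqP; rewrite -subr_eq0; apply/eqP.
have -> : x i - y i = z i by rewrite /z valK.
have z0 : T 1%N = 0 by rewrite -(subnn n) T0.
case: (val i) (ltn_ord i) => [|j] jn.
  by move: z0; rewrite /T big_ord1 mul1r.
by have := T0 (n - j)%N (leq_subr _ _); rewrite subKn ?TE // ltnW // ltnW.
Qed.

Definition greedy_ring (n : nat) : Type := {ffun 'I_n.+1 -> int}.

Section GreedyFusion.
Variable n : nat.
Local Notation T := (greedy_ring n).

HB.instance Definition _ := GRing.Zmodule.copy T {ffun 'I_n.+1 -> int}.

Definition greedy_basis (i : 'I_n.+1) : T := [ffun j => (j == i)%:R].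

Definition greedy_mul (x y : T) : T :=
  [ffun l : 'I_n.+1 => \sum_j \sum_k x j * y k * (greedy_coef j k l)%:R].

Lemma greedy_PhiM (x y : T) m : (0 < m)%N ->
  greedy_Phi (greedy_mul x y) m = greedy_Phi x m * greedy_Phi y m.
Proof.
move=> m0; rewrite /greedy_Phi big_distrl /=.
under eq_bigr do rewrite ffunE big_distrl /=.
rewrite exchange_big; apply: eq_bigr => j _ /=.
under eq_bigr do rewrite big_distrl /=.
rewrite exchange_big big_distrr; apply: eq_bigr => k _ /=.
under eq_bigr do rewrite -mulrA.
by rewrite -big_distrr /= greedy_coef_chi //; ring.
Qed.

Lemma greedy_PhiD (x y : T) m :
  greedy_Phi (x + y) m = greedy_Phi x m + greedy_Phi y m.
Proof.
by rewrite /greedy_Phi -big_split; apply: eq_bigr => i _; rewrite ffunE mulrDl.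
Qed.

Lemma greedy_Phi_basis i m : greedy_Phi (greedy_basis i) m = greedy_chi m i.
Proof.
rewrite /greedy_Phi (bigD1 i) //= big1 ?addr0 ?ffunE ?eqxx ?mul1r // => j ji.
by rewrite ffunE (negbTE ji) mul0r.
Qed.

Lemma greedy_Phi1 m : (0 < m)%N -> greedy_Phi (greedy_basis ord0) m = 1.
Proof. by move=> m0; rewrite greedy_Phi_basis /greedy_chi /= m0. Qed.

Lemma greedy_mulA : associative greedy_mul.
Proof.
by move=> x y z; apply: greedy_Phi_inj => m m0; rewrite !greedy_PhiM // mulrA.
Qed.

Lemma greedy_mulC : commutative greedy_mul.
Proof.
by move=> x y; apply: greedy_Phi_inj => m m0; rewrite !greedy_PhiM // mulrC.
Qed.

Lemma greedy_mul1 : left_id (greedy_basis ord0) greedy_mul.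
Proof.
move=> x; apply: greedy_Phi_inj => m m0.
by rewrite greedy_PhiM // greedy_Phi1 // mul1r.
Qed.

Lemma greedy_mulDl : left_distributive greedy_mul +%R.
Proof.
move=> x y z; apply: greedy_Phi_inj => m m0.
by rewrite !(greedy_PhiM, greedy_PhiD) // mulrDl.
Qed.

Lemma greedy_one_neq0 : greedy_basis ord0 != 0.
Proof. by apply/eqP => /ffunP /(_ ord0); rewrite !ffunE. Qed.

HB.instance Definition _ := GRing.Zmodule_isComNzRing.Build T
  greedy_mulA greedy_mulC greedy_mul1 greedy_mulDl greedy_one_neq0.

Lemma greedy_mulrzE (x : T) (c : int) j : (x *~ c) j = x j * c.
Proof.
case: c => k; rewrite ?NegzE ?mulrNz -pmulrn ?ffunE ffunMnE ?mulrN -mulr_natr;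
by rewrite natz.
Qed.

Lemma greedy_sumE (c : 'I_n.+1 -> int) :
  \sum_i greedy_basis i *~ c i = [ffun i => c i] :> T.
Proof.
apply/ffunP => j; rewrite sum_ffunE ffunE (bigD1 j) //= big1 ?addr0.
  by rewrite greedy_mulrzE ffunE eqxx mul1r.
by move=> i ij; rewrite greedy_mulrzE ffunE eq_sym (negbTE ij) mul0r.
Qed.

Lemma greedy_basisP : Zbasis greedy_basis.
Proof.
move=> x; exists x; split.
  by rewrite greedy_sumE; apply/ffunP => i; rewrite ffunE.
by move=> c ->; rewrite greedy_sumE; apply/ffunP => i; rewrite ffunE.
Qed.

Lemma greedy_Zcoord (x : T) : Zcoord greedy_basisP x = x.
Proof.
by apply: Zcoord_eq; rewrite greedy_sumE; apply/ffunP => i; rewrite ffunE.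
Qed.

Lemma greedy_basisM (j k : 'I_n.+1) : greedy_basis j * greedy_basis k =
  \sum_(l < n.+1) greedy_basis l *~ (greedy_coef j k l)%:Z.
Proof.
rewrite greedy_sumE; apply/ffunP => l; rewrite !ffunE.
rewrite (bigD1 j) //= [X in _ + X]big1 ?addr0; last first.
  move=> i ij; rewrite big1 // => i' _.
  by rewrite !ffunE (negbTE ij) !mul0r.
rewrite (bigD1 k) //= big1 ?addr0; last first.
  by move=> i ik; rewrite !ffunE (negbTE ik) mulr0 mul0r.
by rewrite !ffunE !eqxx !mul1r natz.
Qed.

Lemma greedy_coef_ge0 (j k l : 'I_n.+1) :
  0 <= Zcoord greedy_basisP (greedy_basis j * greedy_basis k) l.
Proof. by rewrite greedy_Zcoord greedy_basisM greedy_sumE ffunE. Qed.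

Lemma greedy_dualM (x y : T) :
  Zlin_ext greedy_basisP id (x * y) =
  Zlin_ext greedy_basisP id y * Zlin_ext greedy_basisP id x.
Proof. by rewrite /Zlin_ext -!ZcoordP mulrC. Qed.

Lemma greedy_coef1 (j k : 'I_n.+1) :
  Zcoord greedy_basisP (greedy_basis j * greedy_basis k) ord0 = (k == j)%:R.
Proof.
rewrite greedy_Zcoord greedy_basisM greedy_sumE ffunE /greedy_coef /=.
rewrite -val_eqE /= [(k == j :> nat)]eq_sym.
case: (j : nat) (k : nat) => [|j'] [|k'] //=.
rewrite !muln0 add0n.
by case: (ltngtP j'.+1 k'.+1).
Qed.

Definition greedy_fusion : fusionRing :=
  @FusionRing T 'I_n.+1 greedy_basis ord0 id greedy_basisP erefl
    greedy_coef_ge0 (fun=> erefl) greedy_dualM greedy_coef1.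

End GreedyFusion.

(* Main.v *)
Require Import Defs.
From HB Require Import structures.
From mathcomp Require Import all_boot all_order all_algebra.
From mathcomp Require Import boolp reals complex ring zify.

Set Implicit Arguments.
Unset Strict Implicit.
Unset Printing Implicit Defensive.

Import Order.TTheory GRing.Theory Num.Theory.
Local Open Scope ring_scope.

(** Write b' for the dual of a basis element b. The proof is an induction on
    [n] that carries along a greedy chain r_0 = 1, r_1, ..., r_n: basis
    elements that are self-dual, multiply as in the greedy fusion ring, and
    are absorbed by everything after them, in the sense that x r_k = r_k x = d_k x for
    every basis element x outside r_0, ..., r_k. Such a chain spans the desired
    subring ([chain_fusionSubring]), so it suffices to lengthen it by one when
    a_n is a formal codegree ([chain_step]).

    Put N = d_(n+1) = a_n - 1, which is also the sum of the squares of
    d_0, ..., d_n. Let phi be irreducible of dimension m with codegree N + 1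
    and trace chi, and let w be the sum over b of chi(b) b' in the complexified
    ring.

    - The element w is central with w^2 = (N+1) w, hence self-adjoint, and
      comparing coefficients of 1 gives sum_b |chi(b)|^2 = (N+1) m
      ([char_norm2]).

    - By Schur's lemma and the quadratic relation for r_k, each r_k acts by d_k
      or by -1. The value -1 at a first k makes everything after r_k act by 0,
      whence m = 1 and the codegree is a_(k-1) instead of a_n. So r_k acts by
      d_k ([rep_chain]), and the norm identity becomes
      m^2 N + sum_(b outside the chain) |chi(b)|^2 = (N+1) m.
      This forces m = 1, except for N = 1 and m = 2, which would make every
      b <> 1 traceless; [traceless_dim2] excludes it. Now chi is a ring
      homomorphism and the sum outside the chain is 1.

    - The vector w satisfies z w = (N+1) w for the Casimir element
      z = sum_b b b', together with r_k w = d_k w. By the Cauchy-Schwarz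
      inequality these linear equations determine w up to a scalar, unless
      N = 1 and z = 2 ([codeg_eigen_unique]); in that case R has two basis
      elements and is the group ring of the group of order 2
      ([chain_step_exceptional]). As the equations have integer coefficients,
      a nonzero multiple D w lies in R. Then all D chi(x) are integers, and if
      0 < |chi(b)| < 1 then multiplying x by b would make them decrease for
      ever. So nonzero values of chi have modulus at least 1, and exactly one
      b outside the chain has chi(b) <> 0, with chi(b) = 1 or -1.

    - The equation x w = chi(x) w, which now holds in R itself, gives b^2 and
      the absorption of b. Nonnegativity of the structure constants takes care
      of the sign, and b can be taken as r_(n+1) ([chain_step_generic]). *)

#[local] Arguments greedy_dim : simpl never.
#[local] Arguments sylvester_prod : simpl never.

(** * Coordinates in the distinguished basis *)

Section Coordinates.
Variable R : fusionRing.
Local Notation I := (fidx R).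
Local Notation b := (@fbasis R).

Definition bcoef (x : R) (i : I) : int := Zcoord (@fbasisP R) x i.

Lemma bcoefE (x : R) : x = \sum_i b i *~ bcoef x i.
Proof. exact: ZcoordP. Qed.

Lemma bcoef_sum (c : I -> int) i : bcoef (\sum_i b i *~ c i) i = c i.
Proof.
rewrite /bcoef (@Zcoord_eq _ _ _ _ _ [ffun i => c i]) ?ffunE //.
by apply: eq_bigr => j _; rewrite ffunE.
Qed.

Lemma bcoef_inj (x y : R) : bcoef x =1 bcoef y -> x = y.
Proof.
by move=> h; rewrite (bcoefE x) (bcoefE y); apply: eq_bigr => i _; rewrite h.
Qed.

Lemma bcoefB x y i : bcoef (x - y) i = bcoef x i - bcoef y i.
Proof.
rewrite -[RHS](bcoef_sum (fun i => bcoef x i - bcoef y i)); congr bcoef.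
rewrite {1}(bcoefE x) {1}(bcoefE y) -sumrB.
by apply: eq_bigr => j _; rewrite mulrzBr.
Qed.

(** A named function, so that it can carry an additive structure. *)
Definition bcoef_at (i : I) (x : R) : int := bcoef x i.

Lemma bcoef_at_additive i : zmod_morphism (bcoef_at i).
Proof. by move=> x y; apply: bcoefB. Qed.

HB.instance Definition _ i :=
  GRing.isZmodMorphism.Build R int (bcoef_at i) (bcoef_at_additive i).

Lemma bcoef0 i : bcoef 0 i = 0.
Proof. exact: (raddf0 (bcoef_at i)). Qed.

Lemma bcoefD x y i : bcoef (x + y) i = bcoef x i + bcoef y i.
Proof. exact: (raddfD (bcoef_at i)). Qed.

Lemma bcoef_bigsum (J : Type) (s : seq J) (P : pred J) (F : J -> R) i :
  bcoef (\sum_(j <- s | P j) F j) i = \sum_(j <- s | P j) bcoef (F j) i.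
Proof. exact: (raddf_sum (bcoef_at i)). Qed.

Lemma bcoefMz x (c : int) i : bcoef (x *~ c) i = bcoef x i * c.
Proof. by rewrite -mulrzz; apply: (raddfMz (bcoef_at i)). Qed.

Lemma bcoefMn x (k : nat) i : bcoef (x *+ k) i = bcoef x i *+ k.
Proof. exact: (raddfMn (bcoef_at i)). Qed.

Lemma bcoef_basis i j : bcoef (b i) j = (j == i)%:R.
Proof.
rewrite -[RHS](bcoef_sum (fun j => (j == i)%:R)); congr bcoef.
rewrite (bigD1 i) //= eqxx big1 ?addr0 // => k /negbTE ->.
by rewrite mulr0z.
Qed.

Lemma bcoef1 j : bcoef 1 j = (j == fone R)%:R.
Proof. by rewrite -fbasis1 bcoef_basis. Qed.

Definition scoef (j k l : I) : int := bcoef (b j * b k) l.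

Lemma scoef_ge0 j k l : 0 <= scoef j k l.
Proof. exact: fcoef_ge0. Qed.

Lemma scoef1 j k : scoef j k (fone R) = (k == fdual j)%:R.
Proof. exact: fcoef1. Qed.

Lemma scoefE j k : b j * b k = \sum_l b l *~ scoef j k l.
Proof. exact: bcoefE. Qed.

Lemma bcoefM x y l :
  bcoef (x * y) l = \sum_j \sum_k bcoef x j * bcoef y k * scoef j k l.
Proof.
rewrite {1}(bcoefE x) {1}(bcoefE y) big_distrl /= bcoef_bigsum.
apply: eq_bigr => j _; rewrite big_distrr /= bcoef_bigsum; apply: eq_bigr => k _.
by rewrite mulrzAr mulrzAl !bcoefMz /scoef [RHS]mulrC mulrA.
Qed.

Lemma scoefA j k l p : \sum_m scoef j k m * scoef m l p =
  \sum_m scoef k l m * scoef j m p.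
Proof.
have <- : bcoef (b j * b k * b l) p = \sum_m scoef j k m * scoef m l p.
  rewrite scoefE big_distrl bcoef_bigsum; apply: eq_bigr => m _ /=.
  by rewrite mulrzAl bcoefMz mulrC.
rewrite -mulrA (scoefE k l) big_distrr bcoef_bigsum; apply: eq_bigr => m _ /=.
by rewrite mulrzAr bcoefMz mulrC.
Qed.

Lemma fdual_inj : injective (@fdual R).
Proof. exact: inv_inj (@fdualK R). Qed.

(** Duality is an anti-involution, read off on structure constants. *)
Lemma scoef_dual j k l : scoef (fdual k) (fdual j) (fdual l) = scoef j k l.
Proof.
have h : Zlin_ext (fbasisP (f:=R)) (@fdual R) (b j * b k) = b (fdual k) * b (fdual j).
  rewrite fdualM; congr (_ * _); rewrite /Zlin_ext.
    rewrite (bigD1 k) //= -/(bcoef _ _) bcoef_basis eqxx mulr1z big1 ?addr0 // => i.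
    by rewrite -/(bcoef _ _) bcoef_basis => /negbTE ->.
  rewrite (bigD1 j) //= -/(bcoef _ _) bcoef_basis eqxx mulr1z big1 ?addr0 // => i.
  by rewrite -/(bcoef _ _) bcoef_basis => /negbTE ->.
rewrite /scoef -h /Zlin_ext (reindex_inj fdual_inj) /=.
under eq_bigr do rewrite fdualK -/(bcoef _ _).
by rewrite (bcoef_sum (fun i => bcoef (b j * b k) (fdual i))) fdualK.
Qed.

Lemma bcoefM1 x y :
  bcoef (x * y) (fone R) = \sum_i bcoef x i * bcoef y (fdual i).
Proof.
rewrite bcoefM; apply: eq_bigr => i _.
rewrite (bigD1 (fdual i)) //= scoef1 eqxx mulr1 big1 ?addr0 // => k /negbTE h.
by rewrite scoef1 h mulr0.
Qed.

(** An anti-involution that is the identity forces commutativity. *)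
Lemma fdual_id_comm : @fdual R =1 id -> forall x y : R, x * y = y * x.
Proof.
move=> h x y; have e z : Zlin_ext (fbasisP (f:=R)) (@fdual R) z = z.
  by rewrite [RHS]bcoefE; apply: eq_bigr => i _; rewrite h.
by rewrite -[LHS]e fdualM !e.
Qed.

Lemma fdual1 : fdual (fone R) = fone R.
Proof.
have := scoef1 (fone R) (fone R).
rewrite /scoef fbasis1 mul1r bcoef1 eqxx.
by case: (fone R =P _).
Qed.

End Coordinates.

(** * The complexified ring, its trace and its conjugation *)

Section Complexification.
Variables (C : numClosedFieldType) (R : fusionRing).
Local Notation I := (fidx R).
Local Notation b := (@fbasis R).

Definition complexified : Type := {ffun I -> C}.
HB.instance Definition _ := GRing.Zmodule.copy complexified {ffun I -> C}.

Definition cinj (x : R) : complexified := [ffun i => (bcoef x i)%:~R].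

Definition cmul (x y : complexified) : complexified :=
  [ffun l => \sum_j \sum_k x j * y k * (scoef j k l)%:~R].

Definition cscale (a : C) (x : complexified) : complexified := [ffun i => a * x i].

Lemma cinjB : zmod_morphism cinj.
Proof. by move=> x y; apply/ffunP => i; rewrite !ffunE bcoefB rmorphB. Qed.
HB.instance Definition _ := GRing.isZmodMorphism.Build R complexified cinj cinjB.

Lemma cinjM_subproof x y : cinj (x * y) = cmul (cinj x) (cinj y).
Proof.
apply/ffunP => l; rewrite !ffunE bcoefM rmorph_sum; apply: eq_bigr => j _ /=.
by rewrite rmorph_sum; apply: eq_bigr => k _ /=; rewrite !ffunE !rmorphM.
Qed.

Lemma cmulA : associative cmul.
Proof.
move=> x y z; apply/ffunP => p; rewrite !ffunE.
pose F j k l m := x j * y k * z l * (scoef k l m * scoef j m p)%:~R.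
transitivity (\sum_j \sum_k \sum_l \sum_m F j k l m).
  apply: eq_bigr => j _.
  under eq_bigr do rewrite ffunE big_distrr big_distrl /=.
  rewrite exchange_big; apply: eq_bigr => k _ /=.
  under eq_bigr do rewrite big_distrr big_distrl /=.
  rewrite exchange_big; apply: eq_bigr => l _ /=.
  by apply: eq_bigr => m _; rewrite /F rmorphM /=; ring.
symmetry.
transitivity (\sum_m \sum_l \sum_j \sum_k
   x j * y k * z l * (scoef j k m * scoef m l p)%:~R).
  apply: eq_bigr => m _; apply: eq_bigr => l _.
  rewrite ffunE !big_distrl /=; apply: eq_bigr => j _.
  rewrite !big_distrl /=; apply: eq_bigr => k _.
  by rewrite rmorphM /=; ring.
under eq_bigr do rewrite exchange_big /=.
rewrite exchange_big; apply: eq_bigr => j _ /=.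
under eq_bigr do rewrite exchange_big /=.
rewrite exchange_big; apply: eq_bigr => k _ /=.
rewrite exchange_big; apply: eq_bigr => l _ /=.
by rewrite -!big_distrr /= -!rmorph_sum /= scoefA.
Qed.

Lemma cmul1l : left_id (cinj 1) cmul.
Proof.
move=> x; apply/ffunP => l; rewrite !ffunE.
rewrite (bigD1 (fone R)) //= [X in _ + X]big1 ?addr0; last first.
  by move=> i /negbTE h; rewrite big1 // => k _; rewrite ffunE bcoef1 h !mul0r.
rewrite (bigD1 l) //= big1 ?addr0 => [|k /negbTE h];
  rewrite ffunE bcoef1 eqxx /scoef fbasis1 mul1r bcoef_basis.
  by rewrite eqxx mul1r mulr1.
by rewrite eq_sym h mulr0.
Qed.

Lemma cmul1r : right_id (cinj 1) cmul.
Proof.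
move=> x; apply/ffunP => l; rewrite !ffunE.
rewrite exchange_big /= (bigD1 (fone R)) //= [X in _ + X]big1 ?addr0; last first.
  by move=> i /negbTE h; rewrite big1 // => k _; rewrite ffunE bcoef1 h mulr0 mul0r.
rewrite (bigD1 l) //= big1 ?addr0 => [|k /negbTE h];
  rewrite ffunE bcoef1 eqxx /scoef fbasis1 mulr1 bcoef_basis.
  by rewrite eqxx !mulr1.
by rewrite eq_sym h mulr0.
Qed.

Lemma cmulDl : left_distributive cmul +%R.
Proof.
move=> x y z; apply/ffunP => l; rewrite !ffunE -big_split; apply: eq_bigr => j _.
by rewrite -big_split; apply: eq_bigr => k _; rewrite ffunE !mulrDl.
Qed.

Lemma cmulDr : right_distributive cmul +%R.
Proof.
move=> x y z; apply/ffunP => l; rewrite !ffunE -big_split; apply: eq_bigr => j _.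
by rewrite -big_split; apply: eq_bigr => k _; rewrite ffunE mulrDr mulrDl.
Qed.

Lemma cone_neq0 : cinj 1 != 0.
Proof.
by apply/eqP => /ffunP /(_ (fone R)) /eqP; rewrite !ffunE bcoef1 eqxx oner_eq0.
Qed.

HB.instance Definition _ := GRing.Zmodule_isNzRing.Build complexified
  cmulA cmul1l cmul1r cmulDl cmulDr cone_neq0.

Lemma cinj_monoid : monoid_morphism cinj.
Proof. by split=> // x y; apply: cinjM_subproof. Qed.
HB.instance Definition _ := GRing.isMonoidMorphism.Build R complexified cinj cinj_monoid.

Lemma cscaleA a a' x : cscale a (cscale a' x) = cscale (a * a') x.
Proof. by apply/ffunP => i; rewrite !ffunE mulrA. Qed.
Lemma cscale1 : left_id 1 cscale.
Proof. by move=> x; apply/ffunP => i; rewrite !ffunE mul1r. Qed.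
Lemma cscaleDr : right_distributive cscale +%R.
Proof. by move=> a x y; apply/ffunP => i; rewrite !ffunE mulrDr. Qed.
Lemma cscaleDl x : {morph cscale^~ x : a a' / a + a'}.
Proof. by move=> a a'; apply/ffunP => i; rewrite !ffunE mulrDl. Qed.
HB.instance Definition _ := GRing.Zmodule_isLmodule.Build C complexified
  cscaleA cscale1 cscaleDr cscaleDl.

Lemma cscaleAl a (x y : complexified) : a *: (x * y) = (a *: x) * y.
Proof.
apply/ffunP => l; rewrite !ffunE big_distrr; apply: eq_bigr => j _ /=.
by rewrite big_distrr; apply: eq_bigr => k _ /=; rewrite ffunE !mulrA.
Qed.
HB.instance Definition _ := GRing.Lmodule_isLalgebra.Build C complexified cscaleAl.

Lemma cscaleAr a (x y : complexified) : a *: (x * y) = x * (a *: y).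
Proof.
apply/ffunP => l; rewrite !ffunE big_distrr; apply: eq_bigr => j _ /=.
by rewrite big_distrr; apply: eq_bigr => k _ /=; rewrite ffunE; ring.
Qed.
HB.instance Definition _ := GRing.Lalgebra_isAlgebra.Build C complexified cscaleAr.

Lemma cscaleE a (x : complexified) i : (a *: x) i = a * x i.
Proof. by rewrite ffunE. Qed.

Lemma caddE (x y : complexified) i : (x + y) i = x i + y i.
Proof. by rewrite ffunE. Qed.

Lemma csumE (J : Type) (s : seq J) (P : pred J) (F : J -> complexified) i :
  (\sum_(j <- s | P j) F j) i = \sum_(j <- s | P j) F j i.
Proof. by elim/big_rec2: _ => [|j x y _ <-]; rewrite ffunE. Qed.

Lemma complexifiedE (x : complexified) : x = \sum_i x i *: cinj (b i).
Proof.
apply/ffunP => j; rewrite csumE (bigD1 j) //= big1 => [|i ij];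
  rewrite cscaleE ffunE bcoef_basis.
  by rewrite eqxx mulr1 addr0.
by rewrite eq_sym (negbTE ij) mulr0.
Qed.

Lemma cinj_inj : injective cinj.
Proof.
move=> x y xy; apply: bcoef_inj => i.
by move/ffunP/(_ i): xy; rewrite !ffunE => /intr_inj.
Qed.

(** The canonical symmetrizing trace of the fusion ring. *)
Definition ctau (x : complexified) : C := x (fone R).

(** The distinguished basis and its dual family are dual bases for the trace;
    this is the last axiom of fusion rings. *)
Lemma ctauM (x y : complexified) : ctau (x * y) = \sum_i x i * y (fdual i).
Proof.
rewrite /ctau ffunE; apply: eq_bigr => i _.
rewrite (bigD1 (fdual i)) //= scoef1 eqxx mulr1 big1 ?addr0 // => k /negbTE h.
by rewrite scoef1 h mulr0.
Qed.

Lemma ctauC (x y : complexified) : ctau (x * y) = ctau (y * x).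
Proof.
rewrite !ctauM (reindex_inj (@fdual_inj R)); apply: eq_bigr => i _ /=.
by rewrite fdualK mulrC.
Qed.

Lemma ctau_basisr (x : complexified) i : ctau (x * cinj (b (fdual i))) = x i.
Proof.
rewrite ctauM (bigD1 i) //= ffunE bcoef_basis eqxx mulr1 big1 ?addr0 // => j ji.
by rewrite ffunE bcoef_basis (inj_eq (@fdual_inj R)) (negbTE ji) mulr0.
Qed.

(** Identities in the complexified ring are proved below by testing against the
    trace, which turns them into identities between characters. *)
Lemma ctau_nondeg (x y : complexified) :
  (forall u, ctau (x * u) = ctau (y * u)) -> x = y.
Proof. by move=> h; apply/ffunP => i; rewrite -!ctau_basisr h. Qed.

Lemma ctauZ a x : ctau (a *: x) = a * ctau x.
Proof. by rewrite /ctau cscaleE. Qed.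

(** The conjugate-linear anti-involution; it makes the complexified ring a
    finite-dimensional star algebra in which the trace is faithful and positive
    ([cnorm2E]). *)
Definition cstar (x : complexified) : complexified := [ffun i => (x (fdual i))^*].

Lemma cstarK : involutive cstar.
Proof. by move=> x; apply/ffunP => i; rewrite !ffunE fdualK conjCK. Qed.

Lemma cstarB x y : cstar (x - y) = cstar x - cstar y.
Proof. by apply/ffunP => i; rewrite !ffunE rmorphB. Qed.

Lemma cstarZ a x : cstar (a *: x) = a^* *: cstar x.
Proof. by apply/ffunP => i; rewrite !ffunE rmorphM. Qed.

Lemma cstarM x y : cstar (x * y) = cstar y * cstar x.
Proof.
apply/ffunP => l; rewrite !ffunE rmorph_sum /=.
rewrite [RHS](reindex_inj (@fdual_inj R)) /= [RHS]exchange_big /=.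
rewrite [RHS](reindex_inj (@fdual_inj R)) /=.
apply: eq_bigr => j _; rewrite rmorph_sum; apply: eq_bigr => k _ /=.
rewrite !ffunE !rmorphM !fdualK /= rmorph_int -{2}(fdualK l) scoef_dual.
by ring.
Qed.

Lemma cstar_basis i : cstar (cinj (b i)) = cinj (b (fdual i)).
Proof.
apply/ffunP => j; rewrite !ffunE !bcoef_basis rmorph_int.
by rewrite -(inj_eq (@fdual_inj R)) fdualK.
Qed.

Definition cnorm2 (x : complexified) : C := \sum_i `|x i| ^+ 2.

Lemma cnorm2E x : cnorm2 x = ctau (x * cstar x).
Proof.
by rewrite ctauM; apply: eq_bigr => i _; rewrite ffunE fdualK normCK.
Qed.

Lemma cnorm2_eq0 x : cnorm2 x = 0 -> x = 0.
Proof.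
move=> h; apply/ffunP => i; rewrite ffunE; apply/eqP.
rewrite -normr_eq0 -sqrf_eq0.
by rewrite (psumr_eq0P (fun i _ => exprn_ge0 2 (normr_ge0 (x i))) h).
Qed.

Lemma cnorm2_ge0 x : 0 <= cnorm2 x.
Proof. by apply: sumr_ge0 => i _; apply: exprn_ge0. Qed.

(** A normal idempotent of a star algebra with faithful positive trace is
    self-adjoint. With u the adjoint of w and v = f w - w u, the product of v
    with its adjoint expands to 0, so f w = w u, which is self-adjoint. *)
Lemma central_quasi_idem_star (w : complexified) (f : C) :
  (forall x, x * w = w * x) -> w * w = f *: w -> f != 0 -> f^* = f ->
  cstar w = w.
Proof.
move=> wC ww f0 fR; set u := cstar w.
have uu : u * u = f *: u by rewrite /u -cstarM ww cstarZ fR.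
have usw : cstar (w * u) = w * u by rewrite cstarM /u cstarK.
have e : f *: w = w * u.
  apply/eqP; rewrite -subr_eq0; apply/eqP; apply: cnorm2_eq0.
  rewrite cnorm2E cstarB cstarZ fR usw -/u.
  suff -> : (f *: w - w * u) * (f *: u - w * u) = 0 by rewrite /ctau ffunE.
  rewrite mulrBl !mulrBr -!scalerAl -!scalerAr mulrA ww -scalerAl.
  rewrite -[w * u * u]mulrA uu -scalerAr.
  rewrite -[w * u * (w * u)]mulrA [u * (w * u)]mulrA wC -[w * u * u]mulrA uu.
  by rewrite -!scalerAr mulrA ww -scalerAl !subrr.
have : cstar (f *: w) = f *: w by rewrite e usw -e.
rewrite cstarZ fR => /(congr1 (fun v => f^-1 *: v)).
by rewrite !scalerA mulVf // !scale1r.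
Qed.

End Complexification.

(** * Characters and formal codegrees *)

Definition no_proper_subrep (C : fieldType) (R : fusionRing) (m : nat)
    (phi : R -> 'M[C]_m) : Prop :=
  forall U : {vspace 'cV[C]_m},
    (forall (x : R) (v : 'cV[C]_m), v \in U -> phi x *m v \in U) ->
    U = 0%VS \/ U = fullv.

Section Representation.
Variables (C : numClosedFieldType) (R : fusionRing) (m : nat).
Variable phi : {rmorphism R -> 'M[C]_m}.
Local Notation I := (fidx R).
Local Notation b := (@fbasis R).

Definition crep (x : complexified C R) : 'M[C]_m := \sum_i x i *: phi (b i).

Lemma crep_inj x : crep (cinj C x) = phi x.
Proof.
rewrite {2}(bcoefE x) rmorph_sum; apply: eq_bigr => i _ /=.
by rewrite ffunE rmorphMz /= scaler_int.
Qed.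

Lemma crepM x y : crep (x * y) = crep x *m crep y.
Proof.
pose F j k l := (x j * y k * (scoef j k l)%:~R) *: phi (b l).
transitivity (\sum_j \sum_k \sum_l F j k l).
  rewrite /crep; under eq_bigr do rewrite ffunE scaler_suml.
  rewrite exchange_big; apply: eq_bigr => j _ /=.
  under eq_bigr do rewrite scaler_suml.
  by rewrite exchange_big.
rewrite /crep mulmx_suml; apply: eq_bigr => j _.
rewrite mulmx_sumr; apply: eq_bigr => k _.
rewrite -scalemxAl -scalemxAr scalerA -[_ *m _]rmorphM scoefE rmorph_sum.
rewrite scaler_sumr; apply: eq_bigr => l _ /=.
by rewrite rmorphMz /= -scaler_int scalerA.
Qed.

Definition cchar (x : complexified C R) : C := \tr (crep x).

(** The element that represents the character through the trace, see
    [ctau_char]; divided by the codegree it is a central idempotent. *)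
Definition char_vec : complexified C R := [ffun i => \tr (phi (b (fdual i)))].
Local Notation w := char_vec.

Lemma ccharE x : cchar x = \sum_i x i * \tr (phi (b i)).
Proof.
by rewrite /cchar raddf_sum; apply: eq_bigr => i _; rewrite /= mxtraceZ.
Qed.

Lemma ctau_char x : ctau (w * x) = cchar x.
Proof.
rewrite ccharE ctauM (reindex_inj (@fdual_inj R)); apply: eq_bigr => i _ /=.
by rewrite ffunE fdualK mulrC.
Qed.

(** Centrality of [char_vec] is the trace property of the character. *)
Lemma char_vec_central x : x * w = w * x.
Proof.
apply: ctau_nondeg => y.
by rewrite -mulrA ctauC -mulrA !ctau_char -mulrA ctau_char /cchar !crepM mxtrace_mulC.
Qed.

Variable f : C.
Hypothesis f_codeg :
  \sum_(i : I) \tr (phi (b i)) *: phi (b (fdual i)) = f%:M.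

Lemma crep_char : crep w = f%:M.
Proof.
rewrite -f_codeg [RHS](reindex_inj (@fdual_inj R)); apply: eq_bigr => i _ /=.
by rewrite ffunE fdualK.
Qed.

Lemma char_vec_sq : w * w = f *: w.
Proof.
apply: ctau_nondeg => y.
by rewrite -mulrA ctau_char /cchar crepM crep_char mul_scalar_mx mxtraceZ
  -scalerAl ctauZ ctau_char.
Qed.

Hypothesis f_gt0 : 0 < f.

Lemma char_vec_star : cstar w = w.
Proof.
apply: (@central_quasi_idem_star _ _ _ f); first exact: char_vec_central.
- exact: char_vec_sq.
- by rewrite gt_eqF.
- by apply/CrealP/gtr0_real.
Qed.

(** Both sides are the trace of the square of [char_vec]: it equals its own
    adjoint on one side, and it is multiplied by [f] on the other. *)
Lemma char_norm2 : \sum_i `|\tr (phi (b i))| ^+ 2 = f * m%:R.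
Proof.
have -> : m%:R = cchar 1.
  by rewrite /cchar (crep_inj 1) rmorph1 mxtrace1.
rewrite -ctau_char mulr1 -ctauZ -char_vec_sq -{2}char_vec_star -cnorm2E.
rewrite [LHS](reindex_inj (@fdual_inj R)); apply: eq_bigr => i _.
by rewrite ffunE.
Qed.

Hypothesis m_gt0 : (0 < m)%N.
Hypothesis irr : no_proper_subrep phi.

(** The kernel of [A] is invariant, hence trivial or everything. This is Schur's
    lemma in the form that suits elements satisfying a known equation. *)
Lemma schur_zero_divisor (A B : 'M[C]_m) :
  (forall x, A *m phi x = phi x *m A) -> A *m B = 0 -> A = 0 \/ B = 0.
Proof.
move=> AC AB; pose L := linfun (mulmx A : 'cV[C]_m -> 'cV[C]_m).
have inU v : (v \in lker L) = (A *m v == 0) by rewrite memv_ker lfunE.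
have [] := irr (U := lker L).
- by move=> x v; rewrite !inU mulmxA AC -mulmxA => /eqP ->; rewrite mulmx0.
- move=> U0; right; apply/matrixP => i j.
  have : col j B \in lker L by rewrite inU colE mulmxA AB mul0mx.
  by rewrite U0 memv0 => /eqP/matrixP/(_ i 0); rewrite !mxE.
- move=> Uf; left; apply/matrixP => i j.
  have : delta_mx j 0 \in lker L by rewrite Uf memvf.
  by rewrite inU -colE => /eqP/matrixP/(_ i 0); rewrite !mxE.
Qed.

Lemma schur_quadratic (g : R) (a c : C) :
  (forall x, g * x = x * g) ->
  (phi g - a%:M) *m (phi g - c%:M) = 0 -> phi g = a%:M \/ phi g = c%:M.
Proof.
move=> gC /schur_zero_divisor [x||].
- by rewrite mulmxBl mulmxBr -scalar_mxC -[phi g *m _]rmorphM gC rmorphM.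
- by move/subr0_eq; left.
- by move/subr0_eq; right.
Qed.

(** Every line is then invariant. *)
Lemma scalar_rep_dim1 : (forall i, exists c, phi (b i) = c%:M) -> m = 1%N.
Proof.
move=> /fin_all_exists[c hc].
have sc x : exists a, phi x = a%:M.
  exists (\sum_i (bcoef x i)%:~R * c i).
  rewrite -crep_inj /crep raddf_sum; apply: eq_bigr => i _ /=.
  by rewrite hc ffunE scale_scalar_mx.
pose v : 'cV[C]_m := delta_mx (Ordinal m_gt0) 0.
have v0 : v != 0.
  by apply/eqP => /matrixP/(_ (Ordinal m_gt0) 0)/eqP; rewrite !mxE !eqxx oner_eq0.
case: (irr (U := <[v]>%VS)).
- move=> x u; have [a ->] := sc x; rewrite mul_scalar_mx; exact: memvZ.
- by move/eqP; rewrite -dimv_eq0 dim_vline v0.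
- by move/(congr1 (fun U => \dim U)); rewrite dim_vline v0 dimvf /dim /= muln1.
Qed.

End Representation.

(** * Greedy chains *)

(** The squared norm of the Frobenius-Perron character on the span of
    r_0, ..., r_k is d_(k+1), one less than the next term of Sylvester's
    sequence. *)
Lemma greedy_sum_sq k : (\sum_(j < k.+1) greedy_dim j * greedy_dim j = greedy_dim k.+1)%N.
Proof.
elim: k => [|k IH]; first by rewrite big_ord1.
by rewrite big_ord_recr [LHS]/= IH (@greedy_dimSS k.+1) // mulnS.
Qed.

Lemma greedy_dim_ltn k l : (0 < k < l)%N -> (greedy_dim k < greedy_dim l)%N.
Proof.
case/andP=> k0; elim: l => // l IH; rewrite ltnS leq_eqVlt => /orP[/eqP <-|kl].
  by rewrite greedy_dimSS // mulnS -[X in (X < _)%N]addn0 ltn_add2l muln_gt0 greedy_dim_gt0.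
apply: leq_trans (IH kl) _; rewrite greedy_dimSS ?(leq_ltn_trans _ kl) //.
by rewrite mulnS leq_addr.
Qed.

Section Chain.
Variable R : fusionRing.
Local Notation I := (fidx R).
Local Notation b := (@fbasis R).
Local Notation d := greedy_dim.

Definition chain_set (r : nat -> I) (k : nat) : {set I} :=
  [set r (j : 'I_k.+1) | j in 'I_k.+1].

(** In [gc_sq] the predecessor is exact because dimensions are positive. The
    condition [gc_absorb] speaks of all basis elements, those of the chain that
    come later as well as those outside it; it encodes the products of
    distinct members and is what makes the induction go through. *)
Record greedy_chain (n : nat) (r : nat -> I) : Prop := GreedyChain {
  gc_one : r 0%N = fone R;
  gc_inj : {in [pred k | k <= n]%N &, injective r};
  gc_dual : forall k, (k <= n)%N -> fdual (r k) = r k;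
  gc_sq : forall k, (k < n)%N -> b (r k.+1) * b (r k.+1) =
    b (r k.+1) *+ (d k.+1).-1 + \sum_(j < k.+1) b (r j) *+ d j;
  gc_absorb : forall k i, (k <= n)%N -> i \notin chain_set r k ->
    b i * b (r k) = b i *+ d k /\ b (r k) * b i = b i *+ d k
}.

Variables (n : nat) (r : nat -> I).
Hypothesis rP : greedy_chain n r.

Lemma chain_setP k i : reflect (exists2 j, (j <= k)%N & i = r j) (i \in chain_set r k).
Proof.
apply: (iffP imsetP) => [[j _ ->]|[j jk ->]].
  by exists j => //; rewrite -ltnS.
by exists (Ordinal (jk : (j < k.+1)%N)).
Qed.

Lemma mem_chain_set k l : (k <= n)%N -> (l <= n)%N ->
  (r l \in chain_set r k) = (l <= k)%N.
Proof.
move=> kn ln; apply/chain_setP/idP => [[j jk /(gc_inj rP)->//]|lk].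
  by rewrite inE (leq_trans jk kn).
by exists l.
Qed.

Lemma chain_sum k (V : nmodType) (F : I -> V) : (k <= n)%N ->
  \sum_i F i = \sum_(j < k.+1) F (r j) + \sum_(i | i \notin chain_set r k) F i.
Proof.
move=> kn; rewrite (bigID [in chain_set r k]) /=; congr (_ + _).
rewrite big_imset //= => i j _ _ /(gc_inj rP) e; apply: val_inj; apply: e;
  by rewrite inE (leq_trans _ kn) // -ltnS.
Qed.

Lemma chain_central k (x : R) : (k <= n)%N -> b (r k) * x = x * b (r k).
Proof.
move=> kn; rewrite (bcoefE x) big_distrr big_distrl; apply: eq_bigr => i _ /=.
rewrite mulrzAr mulrzAl; congr (_ *~ _).
case: (boolP (i \in chain_set r k)) => [/chain_setP[j jk ->]|ik]; last first.
  by have [-> ->] := gc_absorb rP kn ik.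
move: jk; rewrite leq_eqVlt => /orP[/eqP->//|jk].
have jn : (j <= n)%N by apply: leq_trans (ltnW jk) kn.
have [] := @gc_absorb _ _ rP j (r k) jn; first by rewrite mem_chain_set // -ltnNge.
by move=> -> ->.
Qed.

End Chain.

(** * Representations restricted to a greedy chain *)

Section ChainRep.
Variables (C : numClosedFieldType) (R : fusionRing).
Local Notation I := (fidx R).
Local Notation b := (@fbasis R).
Local Notation d := greedy_dim.
Variables (n : nat) (r : nat -> I).
Hypothesis rP : greedy_chain n r.

Section Dim.
Variable m : nat.
Variable phi : {rmorphism R -> 'M[C]_m}.
Hypothesis f_codeg :
  \sum_(i : I) \tr (phi (b i)) *: phi (b (fdual i)) = ((d n.+1).+1%:R)%:M.
Hypothesis m_gt0 : (0 < m)%N.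
Hypothesis irr : no_proper_subrep phi.

(** If r_0, ..., r_(k-1) act by their dimensions, then r_k is a root of
    (t - d_k) (t + 1). When it acts by -1, absorption gives -x = d_k x for all
    later x, so they act by 0; the representation is then one-dimensional with
    codegree d_k + 1, too small since dimensions increase strictly. *)
Lemma rep_chain_step k : (k <= n)%N ->
  (forall j, (j < k)%N -> phi (b (r j)) = (d j)%:R%:M) ->
  phi (b (r k)) = (d k)%:R%:M.
Proof.
case: k => [_ _|k kn IH]; first by rewrite (gc_one rP) fbasis1 rmorph1.
have sq : phi (b (r k.+1)) *m phi (b (r k.+1)) =
    (d k.+1).-1%:R *: phi (b (r k.+1)) + (d k.+1)%:R%:M.
  rewrite -[LHS]rmorphM (gc_sq rP kn) rmorphD rmorphMn scaler_nat; congr (_ + _).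
  rewrite rmorph_sum /= -[in RHS]greedy_sum_sq natr_sum raddf_sum; apply: eq_bigr => j _.
  by rewrite /= rmorphMn /= IH // natrM -scaler_nat scale_scalar_mx.
have d0 : (0 < d k.+1)%N by apply: greedy_dim_gt0.
case: (@schur_quadratic _ _ _ phi irr (b (r k.+1)) (d k.+1)%:R (-1)) => //.
- by move=> x; apply: chain_central rP _ _ kn.
- rewrite mulmxBl !mulmxBr sq mul_mx_scalar mul_scalar_mx -scalar_mxM.
  rewrite scaleN1r opprK mulrN1 raddfN /= opprK -{3}(prednK d0) -natr1 scalerDl scale1r.
  by rewrite [X in X - _]addrAC subrr.
move=> neg.
have zero i : i \notin chain_set r k.+1 -> phi (b i) = 0.
  move=> /(gc_absorb rP kn)[/(congr1 phi) + _].
  rewrite rmorphM rmorphMn /= neg -[_ * _]/(_ *m _) mul_mx_scalar scaleN1r.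
  rewrite -scaler_nat => /eqP; rewrite -subr_eq0 -opprD -{1}[phi _]scale1r -scalerDl.
  by rewrite oppr_eq0 nat1r scaler_eq0 pnatr_eq0 => /eqP.
have m1 : m = 1%N.
  apply: (scalar_rep_dim1 m_gt0 irr) => i.
  case: (boolP (i \in chain_set r k.+1)) => [/chain_setP[j]|/zero->]; last first.
    by exists 0; rewrite raddf0.
  rewrite leq_eqVlt => /orP[/eqP->->|jk ->]; first by exists (-1).
  by exists (d j)%:R; apply: IH.
have mR : m%:R = 1 :> C by rewrite m1.
have trs (a : C) : \tr (a%:M : 'M_m) = a by rewrite mxtrace_scalar m1.
have := char_norm2 f_codeg (ltr0Sn _ _).
rewrite mR mulr1 (chain_sum rP _ kn) big_ord_recr /= neg.
rewrite [X in _ + X = _ -> _]big1 => [|i /zero ->]; last first.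
  by rewrite raddf0 normr0 expr0n.
have -> : \sum_(i < k.+1) `|\tr (phi (b (r i)))| ^+ 2 = (d k.+1)%:R :> C.
  rewrite -[in RHS]greedy_sum_sq natr_sum; apply: eq_bigr => j _.
  by rewrite IH // trs normr_nat -natrX.
rewrite trs normrN1 expr1n addr0 natr1 => /eqP.
rewrite eqr_nat eqSS => /eqP e.
by have := @greedy_dim_ltn k.+1 n.+1 kn; rewrite e ltnn.
Qed.

Lemma rep_chain k : (k <= n)%N -> phi (b (r k)) = (d k)%:R%:M.
Proof.
elim/ltn_ind: k => k IH kn; apply: rep_chain_step => // j jk.
by apply: IH => //; apply: leq_trans (ltnW jk) kn.
Qed.

(** The norm identity [char_norm2] with the contribution of the chain split
    off; it bounds both the dimension and the values outside the chain. *)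
Lemma rep_chain_norm2 : (m * m * d n.+1)%:R +
  \sum_(i | i \notin chain_set r n) `|\tr (phi (b i))| ^+ 2 = ((d n.+1).+1 * m)%:R.
Proof.
rewrite [RHS]natrM -(char_norm2 f_codeg (ltr0Sn _ _)) (chain_sum rP _ (leqnn n)).
congr (_ + _); rewrite -greedy_sum_sq big_distrr natr_sum; apply: eq_bigr => j _.
have jn : (j <= n)%N by rewrite -ltnS.
rewrite rep_chain // mxtrace_scalar -mulrnA.
by rewrite /= normr_nat -natrX expnMn mulnC -!mulnn.
Qed.

End Dim.

(** By Cayley-Hamilton each basis element i <> 1 has a scalar square; as traces
    see only the coefficient of 1, its square is 1 or 0 in R according as i is
    self-dual or not. The value 0 contradicts nonnegativity, so all elements are
    self-dual, R is commutative, and Schur's lemma makes everything scalar. *)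
Lemma traceless_dim2 (phi : {rmorphism R -> 'M[C]_2}) :
  no_proper_subrep phi ->
  ~ (forall i, i != fone R -> \tr (phi (b i)) = 0).
Proof.
move=> irr tr0.
have I2 (i : 'I_2) : i = 0 \/ i = 1.
  by case: i => [[|[|//]] ?]; [left | right]; apply: val_inj.
have CH (A : 'M[C]_2) : \tr A = 0 -> exists c, A *m A = c%:M.
  rewrite /mxtrace big_ord_recl big_ord1 => /eqP; rewrite addr_eq0 => /eqP A0.
  exists (A 0 0 ^+ 2 + A 0 1 * A 1 0).
  apply/matrixP => i j; rewrite !mxE big_ord_recl big_ord1.
  have e1 : lift ord0 ord0 = 1 :> 'I_2 by apply: val_inj.
  rewrite e1 in A0 *; have [->|->] := I2 i.
    have [->|->] := I2 j.
      rewrite A0 /=. ring.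
    rewrite A0 /=. ring.
  have [->|->] := I2 j.
  rewrite A0 /=. ring.
  rewrite A0 /=. ring.
  
have tr x : \tr (phi x) = (bcoef x (fone R))%:~R * 2.
  rewrite {1}(bcoefE x) rmorph_sum raddf_sum (bigD1 (fone R)) //= big1 ?addr0.
    by rewrite rmorphMz /= fbasis1 rmorph1 raddfMz /= mxtrace1 mulrC mulrzr.
  by move=> i i1; rewrite rmorphMz raddfMz /= tr0 // mul0rz.
have sq i : i != fone R -> b i * b i = (i == fdual i)%:R.
  move=> i1; apply: bcoef_inj => l.
  have [c hc] : exists c, phi (b i * b i) = c%:M.
    by rewrite rmorphM; apply: CH; apply: tr0.
  case: (eqVneq l (fone R)) => [->|l1].
    by rewrite -/(scoef i i _) scoef1; case: eqP => _; rewrite ?bcoef0 ?bcoef1 ?eqxx.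
  have e : bcoef (b i * b i * b (fdual l)) (fone R) = bcoef (b i * b i) l.
    rewrite bcoefM1 (bigD1 l) //= bcoef_basis eqxx mulr1 big1 ?addr0 // => k kl.
    by rewrite bcoef_basis (inj_eq (@fdual_inj R)) (negbTE kl) mulr0.
  have := tr (b i * b i * b (fdual l)).
  rewrite e rmorphM hc /= -[_ * _]/(_ *m _) mul_scalar_mx mxtraceZ tr0; last first.
    by rewrite -(fdual1 R) (inj_eq (@fdual_inj R)).
  rewrite mulr0 => /esym/eqP; rewrite mulf_eq0 pnatr_eq0 orbF intr_eq0 => /eqP ->.
  by case: (i == _); rewrite ?bcoef0 ?bcoef1 ?(negbTE l1).
have sd (i : I) : fdual i = i.
  case: (eqVneq i (fone R)) => [->|i1]; first exact: fdual1.
  apply/eqP; case: eqVneq => // ii.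
  have z : b i * b i = 0 by rewrite sq // eq_sym (negbTE ii).
  pose y := b (fdual i) * b i; pose y' := b i * b (fdual i).
  have : bcoef (y * y') (fone R) = 0.
    by rewrite /y /y' mulrA -[b _ * b i * b i]mulrA z mulr0 mul0r bcoef0.
  rewrite bcoefM1 (bigD1 (fone R)) //= fdual1 -!/(scoef _ _ _) !scoef1 fdualK !eqxx mulr1.
  move=> /eqP; rewrite paddr_eq0 ?oner_eq0 //.
  by apply: sumr_ge0 => k _; apply: mulr_ge0; apply: scoef_ge0.
suff : 2%N = 1%N by [].
apply: (scalar_rep_dim1 (phi := phi) _ irr) => // i.
case: (eqVneq i (fone R)) => [->|i1]; first by exists 1; rewrite fbasis1 rmorph1.
case: (@schur_quadratic _ _ _ phi irr (b i) 1 (-1)) => [x||h|h].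
- exact: fdual_id_comm.
- rewrite mulmxBl !mulmxBr -[phi _ *m _]rmorphM sq // sd eqxx rmorph1.
  rewrite mul_mx_scalar mul_scalar_mx -scalar_mxM scale1r scaleN1r opprK mul1r.
  by rewrite raddfN /= opprK [1 + _]addrC subrr.
- by exists 1.
- by exists (-1).
Qed.

End ChainRep.

(** * The Casimir eigenspace attached to a codegree *)

Section CauchySchwarz.
Variables (C : numClosedFieldType) (J : finType).

(** Lagrange's identity, after passing to absolute values. *)
Lemma cauchy_schwarz_sum (a y : J -> C) :
  `|\sum_j a j * y j| ^+ 2 <= (\sum_j `|a j| ^+ 2) * (\sum_j `|y j| ^+ 2).
Proof.
pose p j := `|a j|; pose q j := `|y j|.
have pR j : p j \is Num.real by apply: normr_real.
have qR j : q j \is Num.real by apply: normr_real.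
apply: (@le_trans _ _ ((\sum_j p j * q j) ^+ 2)).
  rewrite lerXn2r ?nnegrE ?normr_ge0 ?sumr_ge0 // => [j _|].
    by rewrite mulr_ge0 ?normr_ge0.
  by apply: le_trans (ler_norm_sum _ _ _) _; apply: ler_sum => j _; rewrite normrM.
rewrite -subr_ge0 -(pmulr_rge0 _ (ltr0Sn C 1)).
have -> : 2 * ((\sum_j p j ^+ 2) * (\sum_j q j ^+ 2) - (\sum_j p j * q j) ^+ 2) =
    \sum_i \sum_j (p i * q j - p j * q i) ^+ 2.
  pose F i j := p i ^+ 2 * q j ^+ 2.
  have FE : (\sum_j p j ^+ 2) * (\sum_j q j ^+ 2) = \sum_i \sum_j F i j.
    by rewrite big_distrl; apply: eq_bigr => i _; rewrite big_distrr.
  have FE' : (\sum_j p j ^+ 2) * (\sum_j q j ^+ 2) = \sum_i \sum_j F j i.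
    by rewrite FE exchange_big.
  rewrite mulrBr mulr_natl mulr2n {1}FE FE' expr2 big_distrl mulr_sumr -big_split -sumrB.
  apply: eq_bigr => i _ /=; rewrite big_distrr mulr_sumr -big_split -sumrB.
  by apply: eq_bigr => j _; rewrite /F /=; ring.
apply: sumr_ge0 => i _; apply: sumr_ge0 => j _.
by rewrite real_exprn_even_ge0 // rpredB // rpredM.
Qed.

Lemma cnorm2_sum (R : fusionRing) (a : J -> C) (y : J -> complexified C R) :
  cnorm2 (\sum_j a j *: y j) <= (\sum_j `|a j| ^+ 2) * \sum_j cnorm2 (y j).
Proof.
rewrite /cnorm2 [X in _ * X]exchange_big mulr_sumr; apply: ler_sum => i _ /=.
rewrite csumE; under [X in `|X|]eq_bigr do rewrite cscaleE.
exact: cauchy_schwarz_sum.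
Qed.

End CauchySchwarz.

Section Eigenspace.
Variables (C : numClosedFieldType) (R : fusionRing).
Local Notation I := (fidx R).
Local Notation b := (@fbasis R).
Local Notation d := greedy_dim.
Local Notation cinj := (@cinj C R).

(** It acts on a one-dimensional representation by its formal codegree
    ([codeg_casimir]), and being an element of [R] it turns the search for the
    character into linear equations over the integers. *)
Definition casimir : R := \sum_i b i * b (fdual i).

Lemma sum_cnorm2_casimir (v : complexified C R) :
  \sum_i cnorm2 (cinj (b (fdual i)) * v) = ctau (cinj casimir * v * cstar v).
Proof.
rewrite /casimir rmorph_sum !big_distrl /ctau csumE; apply: eq_bigr => i _ /=.
rewrite cnorm2E cstarM cstar_basis fdualK rmorphM.
by rewrite -/(ctau _) [X in ctau X = _]mulrA [LHS]ctauC !mulrA.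
Qed.

(** Write the adjoint of [v] in the basis and apply Cauchy-Schwarz to
    sum_b (coefficient) b v: the squared norms of the b v add up to the trace
    of the Casimir element against v and its adjoint. *)
Lemma cnorm2_star_mul_le (v : complexified C R) (a : C) : cinj casimir * v = a *: v ->
  cnorm2 (v * cstar v) <= a * cnorm2 v ^+ 2.
Proof.
move=> zv.
have -> : cnorm2 (v * cstar v) = cnorm2 (cstar v * v).
  by rewrite !cnorm2E !cstarM !cstarK !mulrA [LHS]ctauC !mulrA.
have {1}-> : cstar v = \sum_i cstar v (fdual i) *: cinj (b (fdual i)).
  rewrite {1}(complexifiedE (cstar v)) (reindex_inj (@fdual_inj R)) //.
rewrite big_distrl /=; under eq_bigr do rewrite -scalerAl.
apply: le_trans (cnorm2_sum _ _) _.
rewrite sum_cnorm2_casimir zv -scalerAl ctauZ -cnorm2E.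
suff -> : \sum_j `|cstar v (fdual j)| ^+ 2 = cnorm2 v by rewrite mulrCA -expr2.
by apply: eq_bigr => i _; rewrite ffunE fdualK norm_conjC.
Qed.

Variables (n : nat) (r : nat -> I).

(** What remains of a representation of codegree a_n once it is known to be
    one-dimensional: its value at [x] is the trace of [w * x]. *)
Record codeg_vector (w : complexified C R) : Prop := CodegVector {
  cv_central : forall x, x * w = w * x;
  cv_eigen : forall x, x * w = ctau (w * x) *: w;
  cv_one : w (fone R) = 1;
  cv_star : forall i, w (fdual i) = (w i)^*;
  cv_chain : forall k, (k <= n)%N -> w (r k) = (d k)%:R;
  cv_norm2 : cnorm2 w = (d n.+1).+1%:R
}.

Hypothesis rP : greedy_chain n r.
Variable w : complexified C R.
Hypothesis wP : codeg_vector w.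
Local Notation N := (d n.+1).

Lemma codeg_basis i : cinj (b i) * w = (w i)^* *: w.
Proof.
by rewrite (cv_eigen wP) -{1}(fdualK i) ctau_basisr (cv_star wP).
Qed.

Lemma codeg_casimir : cinj casimir * w = (N.+1)%:R *: w.
Proof.
rewrite /casimir rmorph_sum big_distrl -(cv_norm2 wP) /cnorm2 scaler_suml.
apply: eq_bigr => i _ /=; rewrite rmorphM -mulrA codeg_basis (cv_star wP) conjCK.
by rewrite -scalerAr codeg_basis scalerA normCK.
Qed.

Lemma codeg_chain k : (k <= n)%N -> cinj (b (r k)) * w = (d k)%:R *: w.
Proof. by move=> kn; rewrite codeg_basis (cv_chain wP) // conjC_nat. Qed.

Lemma codeg_rest : \sum_(i | i \notin chain_set r n) `|w i| ^+ 2 = 1.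
Proof.
have := cv_norm2 wP; rewrite /cnorm2 (chain_sum rP _ (leqnn n)).
under eq_bigr => j _.
  rewrite (cv_chain wP); last by rewrite -ltnS.
  rewrite normr_nat -natrX -mulnn; over.
by rewrite -natr_sum greedy_sum_sq -natr1 => /addrI.
Qed.

(** Let y be the product of v with its adjoint and c its trace. The equations for
    r_k give y the coefficients c d_k on the chain, and y is orthogonal to w, so
    the part of y outside the chain pairs with that of w, a unit vector, to
    - c N. Cauchy-Schwarz makes its squared norm at least c^2 N^2, whereas
    [cnorm2_star_mul_le] leaves at most (N+1) c^2 - N c^2 = c^2. Hence N = 1,
    and equality in Cauchy-Schwarz reads y + c w = 2 c. Both y and w are
    eigenvectors of the Casimir element for 2, so 1 is one as well. *)
Lemma codeg_orthogonal (v : complexified C R) :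
  cinj casimir * v = (N.+1)%:R *: v ->
  (forall k, (k <= n)%N -> cinj (b (r k)) * v = (d k)%:R *: v) ->
  w * v = 0 -> v != 0 -> N = 1%N /\ casimir = 2%:R.
Proof.
move=> zv rv wv v0; pose y := v * cstar v; pose c := cnorm2 v.
have c_gt0 : 0 < c.
  by rewrite lt0r cnorm2_ge0 andbT; apply: contra v0 => /eqP/cnorm2_eq0->.
have cR : c^* = c by apply/CrealP/gtr0_real.
have yr k : (k <= n)%N -> y (r k) = (d k)%:R * c.
  move=> kn; rewrite -ctau_basisr (gc_dual rP kn) ctauC mulrA rv //.
  by rewrite -scalerAl ctauZ -cnorm2E.
pose Q := \sum_(i | i \notin chain_set r n) `|y i| ^+ 2.
pose T := \sum_(i | i \notin chain_set r n) y i * (w i)^*.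
have TE : T = - (c * N%:R).
  apply/eqP; rewrite -addr_eq0 addrC; apply/eqP.
  have : ctau (y * w) = 0 by rewrite ctauC mulrA wv mul0r /ctau ffunE.
  rewrite ctauM (chain_sum rP _ (leqnn n)) => <-; congr (_ + _); last first.
    by apply: eq_bigr => i _; rewrite (cv_star wP).
  rewrite -greedy_sum_sq natr_sum mulr_sumr; apply: eq_bigr => j _.
  have jn : (j <= n)%N by rewrite -ltnS.
  by rewrite (gc_dual rP) // yr // (cv_chain wP) // natrM; ring.
have TR : T^* = T by rewrite TE rmorphN rmorphM rmorph_nat /= cR.
have QE : cnorm2 y = c ^+ 2 * N%:R + Q.
  rewrite /cnorm2 (chain_sum rP _ (leqnn n)); congr (_ + _).
  rewrite -greedy_sum_sq natr_sum mulr_sumr; apply: eq_bigr => j _.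
  have jn : (j <= n)%N by rewrite -ltnS.
  by rewrite yr // normrM normr_nat gtr0_norm // natrM; ring.
have Qle : Q <= c ^+ 2.
  have := cnorm2_star_mul_le zv; rewrite -/y QE -/c -natr1 mulrDl mul1r mulrC.
  by rewrite lerD2l.
(* The nonnegative quantity behind Cauchy-Schwarz for the parts outside the
   chain, kept explicit because its vanishing is used. *)
pose S := \sum_(i | i \notin chain_set r n) `|y i + c * N%:R * w i| ^+ 2.
have SE : S = Q - (c * N%:R) ^+ 2.
  have -> : S = Q + (c * N%:R) * T + (c * N%:R) * T^* +
      (c * N%:R) ^+ 2 * \sum_(i | i \notin chain_set r n) `|w i| ^+ 2.
    rewrite rmorph_sum !mulr_sumr -!big_split; apply: eq_bigr => i _ /=.
    rewrite !normCK !(rmorphD, rmorphM) /= rmorph_nat cR conjCK; ring.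
  by rewrite codeg_rest TR TE; ring.
have S0 : 0 <= S by apply: sumr_ge0 => i _; apply: exprn_ge0.
have N1 : N = 1%N.
  apply/eqP; rewrite eqn_leq greedy_dim_gt0 andbT.
  have : (c * N%:R) ^+ 2 <= c ^+ 2.
    by apply: le_trans Qle; rewrite -subr_ge0 -SE.
  rewrite exprMn ger_pMr ?exprn_gt0 // -natrX -[1]/(1%:R) ler_nat.
  by rewrite -[X in (_ <= X)%N]/(1 ^ 2)%N leq_sqr.
split=> //.
have S00 : S = 0.
  by apply/eqP; rewrite eq_le S0 andbT SE N1 mulr1 subr_le0.
have n0 : n = 0%N.
  case: (n) N1 => // n' e.
  by have := @greedy_dim_ltn 1 n'.+2 isT; rewrite e.
(* Here the chain is reduced to 1. *)
have yw : y + c *: w = (2%:R * c) *: 1.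
  apply/ffunP => i; rewrite caddE !cscaleE.
  have -> : (1 : complexified C R) i = (i == fone R)%:R.
    by rewrite -(rmorph1 cinj) ffunE bcoef1; case: eqP.
  case: (boolP (i \in chain_set r n)) => [/chain_setP[j]|ic].
    rewrite n0 leqn0 => /eqP -> ->.
    rewrite yr // (cv_chain wP) // (gc_one rP) eqxx; ring.
  have /eqP := psumr_eq0P (fun i _ => exprn_ge0 2 (normr_ge0 _)) S00 ic.
  rewrite sqrf_eq0 normr_eq0 N1 mulr1 => /eqP ->.
  case: eqP ic => [->|_ _]; last by rewrite mulr0.
  by rewrite -(gc_one rP) (mem_chain_set rP).
have : cinj casimir * (y + c *: w) = 2%:R *: (y + c *: w).
  rewrite mulrDr scalerDr mulrA zv -scalerAr codeg_casimir N1 -scalerAl.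
  by congr (_ + _); rewrite !scalerA mulrC.
have c20 : 2%:R * c != 0 by rewrite mulf_neq0 ?pnatr_eq0 ?gt_eqF.
rewrite yw -scalerAr mulr1 scalerA [in RHS]mulrC -[RHS]scalerA.
by move=> /(scalerI c20) e; apply: (@cinj_inj C); rewrite e rmorph_nat scaler_nat.
Qed.

(** Apply [codeg_orthogonal] to the component (N+1) v - w v, which [w] kills. *)
Lemma codeg_eigen_unique (v : complexified C R) : ~ (N = 1%N /\ casimir = 2%:R) ->
  cinj casimir * v = (N.+1)%:R *: v ->
  (forall k, (k <= n)%N -> cinj (b (r k)) * v = (d k)%:R *: v) ->
  v = v (fone R) *: w.
Proof.
move=> gen zv rv.
have N0 : (N.+1)%:R != 0 :> C by rewrite pnatr_eq0.
have wv : w * v = ctau (w * v) *: w by rewrite -[LHS](cv_central wP) [LHS](cv_eigen wP).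
have e : (N.+1)%:R *: v = w * v.
  apply/eqP; rewrite -subr_eq0; apply: contra_notT gen => v'0.
  apply: codeg_orthogonal v'0.
  - by rewrite mulrBr -scalerAr zv wv -scalerAr codeg_casimir scalerBr !scalerA [ctau _ * _]mulrC.
  - move=> k kn; rewrite mulrBr -scalerAr rv // wv -scalerAr codeg_chain //.
    by rewrite scalerBr !scalerA [ctau _ * _]mulrC [(N.+1)%:R * _]mulrC.
  have ww : w * w = (N.+1)%:R *: w.
    rewrite (cv_eigen wP) -(cv_norm2 wP) cnorm2E; congr (ctau (_ * _) *: _).
    by apply/ffunP => i; rewrite ffunE (cv_star wP) conjCK.
  by rewrite mulrBr -scalerAr mulrA ww -scalerAl subrr.
have := congr1 (fun x : complexified C R => x (fone R)) e.
rewrite wv !cscaleE (cv_one wP) mulr1 => e1.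
by apply: (scalerI N0); rewrite e wv -e1 scalerA.
Qed.

End Eigenspace.

Section CodegVectorOfRep.
Variables (C : numClosedFieldType) (R : fusionRing) (n : nat) (r : nat -> fidx R).
Hypothesis rP : greedy_chain n r.
Local Notation b := (@fbasis R).
Local Notation d := greedy_dim.

(** The norm identity gives m N <= N + 1. This leaves m = 2 with N = 1, where
    nothing remains for the traces outside 1. *)
Lemma codeg_rep_dim1 (m : nat) (phi : {rmorphism R -> 'M[C]_m}) :
  \sum_i \tr (phi (b i)) *: phi (b (fdual i)) = ((d n.+1).+1%:R)%:M ->
  (0 < m)%N ->
  no_proper_subrep phi -> m = 1%N.
Proof.
move=> f_codeg m0 irr.
have := rep_chain_norm2 rP f_codeg m0 irr.
set S := \sum_(i | _) _ => e.
have S0 : 0 <= S by apply: sumr_ge0 => i _; apply: exprn_ge0.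
have le : (m * m * d n.+1 <= (d n.+1).+1 * m)%N.
  by rewrite -(ler_nat C) -e lerDl.
have [//|m1] : m = 1%N \/ m <> 1%N by case: (m =P 1%N); [left|right].
have d0 : (0 < d n.+1)%N := greedy_dim_gt0 _.
have [d1 m2] : d n.+1 = 1%N /\ m = 2%N by nia.
subst m; exfalso; apply: (traceless_dim2 irr) => i i1.
have n0 : n = 0%N.
  case: (n) d1 => // n' e1.
  by have := @greedy_dim_ltn 1 n'.+2 isT; rewrite e1.
have S00 : S = 0.
  by move: e; rewrite d1 muln1 -[X in _ = X]addr0 => /addrI.
have ic : i \notin chain_set r n.
  apply/chain_setP => -[j]; rewrite n0 leqn0 => /eqP-> ir.
  by move: i1; rewrite ir (gc_one rP) eqxx.
have /eqP := psumr_eq0P (fun i _ => exprn_ge0 2 (normr_ge0 _)) S00 ic.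
by rewrite sqrf_eq0 normr_eq0 => /eqP.
Qed.

Lemma codeg_vector_of_rep (m : nat) (phi : {rmorphism R -> 'M[C]_m}) :
  \sum_i \tr (phi (b i)) *: phi (b (fdual i)) = ((d n.+1).+1%:R)%:M ->
  (0 < m)%N ->
  no_proper_subrep phi -> exists w : complexified C R, codeg_vector n r w.
Proof.
move=> f_codeg m0 irr; have m1 := codeg_rep_dim1 f_codeg m0 irr; subst m.
have f0 : 0 < (d n.+1).+1%:R :> C by rewrite ltr0Sn.
have wst := char_vec_star f_codeg f0.
exists (char_vec phi); split.
- exact: char_vec_central.
- move=> x; apply: ctau_nondeg => y.
  rewrite char_vec_central -mulrA -scalerAl ctauZ !ctau_char /cchar crepM.
  by rewrite (mx11_scalar (crep phi x)) mul_scalar_mx mxtraceZ mxtrace_scalar.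
- by rewrite ffunE fdual1 fbasis1 rmorph1 mxtrace1.
- by move=> i; rewrite -[in LHS]wst ffunE fdualK.
- move=> k kn; rewrite ffunE (gc_dual rP kn).
  by rewrite (rep_chain rP f_codeg m0 irr kn) mxtrace_scalar.
- rewrite -[RHS]mulr1 -(char_norm2 f_codeg f0) [RHS](reindex_inj (@fdual_inj R)).
  by apply: eq_bigr => i _; rewrite ffunE.
Qed.

End CodegVectorOfRep.

(** * Integer eigenvectors *)

(** Kernels commute with extension of scalars from the rationals; then
    denominators are cleared. *)
Lemma int_kernel (F : numFieldType) (I J : finType) (A : I -> J -> int) (w : I -> F) :
  (forall j, \sum_i w i * (A i j)%:~R = 0) -> (exists i, w i != 0) ->
  exists2 v : I -> int, exists i, v i != 0 & forall j, \sum_i v i * A i j = 0.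
Proof.
move=> wA [i0 wi0].
pose M : 'M[rat]_(#|I|, #|J|) := \matrix_(i, j) (A (enum_val i) (enum_val j))%:~R.
pose u : 'rV[F]_#|I| := \row_i w (enum_val i).
have uM : u *m map_mx ratr M = 0.
  apply/rowP => j; rewrite !mxE -[RHS](wA (enum_val j)).
  rewrite [RHS](reindex_onto enum_val enum_rank (fun i _ => enum_rankK i)) /=.
  by apply: eq_big => i; [rewrite enum_valK eqxx|move=> _; rewrite !mxE ratr_int].
have K0 : kermx M != 0.
  apply: contraNneq wi0 => K0.
  have : (u <= kermx (map_mx (@ratr F) M))%MS by apply/sub_kermxP.
  rewrite -map_kermx K0 map_mx0 submx0 => /eqP/rowP/(_ (enum_rank i0)).
  by rewrite !mxE enum_rankK => ->.
pose v0 := nz_row (kermx M).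
have v00 : v0 != 0 by rewrite nz_row_eq0.
have v0M : v0 *m M = 0 by apply/sub_kermxP; apply: nz_row_sub.
pose D : int := \prod_k denq (v0 0 k).
have D0 : D != 0 by rewrite /D prodf_seq_neq0; apply/allP => k _ /=; rewrite denq_neq0.
pose v i : int := numq (v0 0 (enum_rank i)) * \prod_(k | k != enum_rank i) denq (v0 0 k).
have vE i : (v i)%:~R = v0 0 (enum_rank i) * D%:~R.
  rewrite /D (bigD1 (enum_rank i)) //= !intrM mulrA; congr (_ * _).
  by rewrite -{2}[v0 0 _]divq_num_den mulfVK // intr_eq0 denq_neq0.
exists v.
  have /rV0Pn[k vk] := v00; exists (enum_val k).
  by rewrite -(intr_eq0 rat) vE enum_valK mulf_neq0 // intr_eq0.
move=> j; apply/eqP; rewrite -(intr_eq0 rat) rmorph_sum /=.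
move/rowP/(_ (enum_rank j)): v0M; rewrite !mxE => e.
rewrite (_ : \sum_i _ = D%:~R * \sum_k v0 0 k * M k (enum_rank j)); first by rewrite e mulr0.
rewrite mulr_sumr [LHS](reindex_onto enum_val enum_rank (fun i _ => enum_rankK i)) /=.
apply: eq_big => i; first by rewrite enum_valK eqxx.
by move=> _; rewrite intrM vE mxE !enum_valK enum_rankK mulrCA mulrA.
Qed.

Section IntegerEigenvector.
Variables (C : numClosedFieldType) (R : fusionRing).
Local Notation b := (@fbasis R).

(** In coordinates the eigenvalue equations are linear with integer coefficients. *)
Lemma int_eigenvector (T : finType) (g : T -> R) (l : T -> int) (w : complexified C R) :
  w != 0 -> (forall t, cinj C (g t) * w = (l t)%:~R *: w) ->
  exists2 v : R, v != 0 & forall t, g t * v = v *~ l t.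
Proof.
move=> w0 gw.
pose A (i : fidx R) (ti : T * fidx R) : int :=
  bcoef (g ti.1 * b i) ti.2 - bcoef (b i) ti.2 * l ti.1.
have [|| v v0 vA] := @int_kernel C _ _ A w.
- case=> t k; have /ffunP/(_ k) := gw t.
  rewrite {1}(complexifiedE w) big_distrr csumE cscaleE => /eqP.
  rewrite -subr_eq0 {2}(complexifiedE w) csumE mulr_sumr -sumrB => /eqP e.
  rewrite -[RHS]e; apply: eq_bigr => i _ /=.
  by rewrite -scalerAr -rmorphM !cscaleE !ffunE /A rmorphB rmorphM /=; ring.
- apply: contrapT => h; case/negP: w0; apply/eqP/ffunP => i; rewrite ffunE.
  by apply/eqP/negPn/negP => wi; apply: h; exists i.
exists (\sum_i b i *~ v i).
  case: v0 => i; apply: contra => /eqP/(congr1 (fun x => bcoef x i)).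
  by rewrite bcoef_sum bcoef0 => ->.
move=> t; apply: bcoef_inj => k; rewrite bcoefMz bcoef_sum.
apply/eqP; rewrite -subr_eq0 -[X in _ == X](vA (t, k)) big_distrr bcoef_bigsum.
rewrite -(bcoef_sum v k) bcoef_bigsum mulr_suml -sumrB; apply/eqP.
by apply: eq_bigr => i _; rewrite /A /= mulrzAr !bcoefMz; ring.
Qed.

End IntegerEigenvector.

(** * Extending a greedy chain *)

Section ChainExtension.
Variables (R : fusionRing) (n : nat) (r : nat -> fidx R).
Hypothesis rP : greedy_chain n r.
Local Notation I := (fidx R).
Local Notation b := (@fbasis R).
Local Notation d := greedy_dim.

Lemma greedy_chain_extend (i0 : I) :
  i0 \notin chain_set r n -> fdual i0 = i0 ->
  b i0 * b i0 = b i0 *+ (d n.+1).-1 + \sum_(j < n.+1) b (r j) *+ d j ->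
  (forall i, i \notin chain_set r n -> i != i0 ->
    b i * b i0 = b i *+ d n.+1 /\ b i0 * b i = b i *+ d n.+1) ->
  exists r' : nat -> I, greedy_chain n.+1 r'.
Proof.
move=> i0n i0d i0sq i0abs; pose r' k := if k == n.+1 then i0 else r k.
have rlt k : (k <= n)%N -> r' k = r k by move=> kn; rewrite /r' ltn_eqF.
have rmax : r' n.+1 = i0 by rewrite /r' eqxx.
have csle k : (k <= n)%N -> chain_set r' k = chain_set r k.
  move=> kn; apply: eq_imset => j; apply: rlt.
  by apply: leq_trans kn; rewrite -ltnS.
have rne k : (k <= n)%N -> r k <> i0.
  by move=> kn e; move/chain_setP: i0n; apply; exists k.
have sumr k : (k <= n)%N -> \sum_(j < k.+1) b (r' j) *+ d j = \sum_(j < k.+1) b (r j) *+ d j.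
  move=> kn; apply: eq_bigr => j _; rewrite rlt //.
  by apply: leq_trans kn; rewrite -ltnS.
exists r'; split.
- by rewrite rlt // (gc_one rP).
- have split_le k : (k <= n.+1)%N -> k = n.+1 \/ (k <= n)%N.
    by rewrite leq_eqVlt => /orP[/eqP|]; [left|right].
  move=> j k; rewrite !inE => /split_le[->|jn] /split_le[->|kn] //; rewrite ?rmax ?rlt //.
  + by move=> /esym/rne; case.
  + by move=> /rne; case.
  + by apply: (gc_inj rP).
- move=> k; rewrite leq_eqVlt ltnS => /orP[/eqP->|kn]; first by rewrite rmax.
  by rewrite rlt // (gc_dual rP).
- move=> k; rewrite ltnS leq_eqVlt => /orP[/eqP->|kn].
    by rewrite rmax sumr.
  by rewrite rlt // sumr ?(gc_sq rP) // ltnW.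
- move=> k i; rewrite leq_eqVlt ltnS => /orP[/eqP->|kn].
    rewrite rmax => ic; apply: i0abs.
      apply: contra ic => /chain_setP[j jn ->].
      by apply/chain_setP; exists j; rewrite ?rlt // leqW.
    by apply: contra ic => /eqP->; apply/chain_setP; exists n.+1.
  by rewrite csle // rlt //; apply: (gc_absorb rP).
Qed.

End ChainExtension.

Section ChainStep.
Variables (C : numClosedFieldType) (R : fusionRing) (n : nat) (r : nat -> fidx R).
Hypothesis rP : greedy_chain n r.
Variable w : complexified C R.
Hypothesis wP : codeg_vector n r w.
Local Notation I := (fidx R).
Local Notation b := (@fbasis R).
Local Notation d := greedy_dim.
Local Notation N := (d n.+1).

(** The sum spans the ideal of the subring on which each r_j acts by d_j;
    elements outside absorb every r_j, so the factor is sum_j d_j^2 = N. *)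
Lemma chain_absorb_sum i : i \notin chain_set r n ->
  b i * (\sum_(j < n.+1) b (r j) *+ d j) = b i *+ N /\
  (\sum_(j < n.+1) b (r j) *+ d j) * b i = b i *+ N.
Proof.
move=> ic.
have abs (j : 'I_n.+1) : b i * b (r j) = b i *+ d j /\ b (r j) * b i = b i *+ d j.
  have jn : (j <= n)%N by rewrite -ltnS.
  apply: (gc_absorb rP jn); apply: contra ic => /chain_setP[k kj ->].
  by apply/chain_setP; exists k => //; apply: leq_trans kj jn.
rewrite -greedy_sum_sq -sumrMnr big_distrl big_distrr /=.
by split; apply: eq_bigr => j _; have [e e'] := abs j;
  rewrite ?mulrnAr ?mulrnAl ?e ?e' mulrnA.
Qed.

(** Uniqueness of the eigenvector makes the character integral up to a common
    denominator, a descent makes it integral, and its square sum 1 outside the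
    chain singles out one basis element. *)
Lemma chain_step_generic : ~ (N = 1%N /\ casimir R = 2%:R) ->
  exists r' : nat -> I, greedy_chain n.+1 r'.
Proof.
move=> gen.
have [v v0 [zv rv]] : exists2 v : R, v != 0 & casimir R * v = v *+ N.+1 /\
    forall k, (k <= n)%N -> b (r k) * v = v *+ d k.
  have w0 : w != 0.
    by apply/eqP => /ffunP/(_ (fone R))/eqP; rewrite (cv_one wP) ffunE oner_eq0.
  pose g (t : option 'I_n.+1) := oapp (fun j => b (r (nat_of_ord j))) (casimir R) t.
  pose l (t : option 'I_n.+1) : int := oapp (fun j => (d (nat_of_ord j))%:Z) N.+1%:Z t.
  have [|v v0 gv] := @int_eigenvector C R _ g l w w0.
    case=> [j|] /=; last exact: codeg_casimir wP.
    by rewrite (codeg_chain wP) // -ltnS.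
  exists v => //; split; first exact: (gv None).
  by move=> k kn; have := gv (Some (Ordinal (kn : (k < n.+1)%N))).
pose D := bcoef v (fone R).
have vE : cinj C v = D%:~R *: w.
  rewrite [LHS](codeg_eigen_unique rP wP gen); first by rewrite ffunE.
  - by rewrite -rmorphM zv rmorphMn scaler_nat.
  - by move=> k kn; rewrite -rmorphM rv // rmorphMn scaler_nat.
have D0 : D != 0.
  apply: contraNneq v0 => D0; apply/eqP/(@cinj_inj C).
  by rewrite vE D0 scale0r rmorph0.
pose e (x : R) : int := bcoef (v * x) (fone R).
have eM x i : (e (x * b i))%:~R = (e x)%:~R * (w i)^* :> C.
  have eE y : (e y)%:~R = D%:~R * ctau (w * cinj C y) :> C.
    by rewrite -ctauZ scalerAl -vE -rmorphM /ctau ffunE.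
  rewrite !eE -mulrA; congr (_ * _).
  have wx : w * cinj C x = ctau (w * cinj C x) *: w.
    by rewrite -[LHS](cv_central wP) [LHS](cv_eigen wP).
  rewrite rmorphM mulrA [in LHS]wx -scalerAl ctauZ; congr (_ * _).
  rewrite ctauC (codeg_basis wP).
  by rewrite ctauZ /ctau (cv_one wP) mulr1.
have w_ge1 i : w i != 0 -> 1 <= `|w i|.
  move=> wi; rewrite real_leNgt ?normr_real //; apply/negP => w1.
  (* Descent: multiplying by the i-th basis element multiplies the integer [e x]
     by a number of modulus strictly between 0 and 1. *)
  have e0 k : forall x, (`|e x| <= k)%N -> e x = 0.
    elim: k => [|k IH] x; first by rewrite leqn0 absz_eq0 => /eqP.
    case: (eqVneq (e x) 0) => // ex le.
    have : e (x * b i) = 0.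
      apply: IH; rewrite -ltnS (leq_trans _ le) // -(ltr_nat C) !natr_absz !intr_norm.
      by rewrite eM normrM norm_conjC gtr_pMr // normr_gt0 intr_eq0.
    move/(congr1 (fun z : int => z%:~R : C))/eqP.
    by rewrite eM mulf_eq0 conjC_eq0 (negbTE wi) orbF intr_eq0 (negbTE ex).
  by have := e0 _ 1 (leqnn _); rewrite /e mulr1 => /eqP; rewrite (negbTE D0).
have [i0 ic wi0] : exists2 i0, i0 \notin chain_set r n & w i0 != 0.
  apply: contrapT => h; have := codeg_rest rP wP; rewrite big1 => [/eqP|i ic].
    by rewrite eq_sym oner_eq0.
  case: (eqVneq (w i) 0) => [->|wi]; first by rewrite normr0 expr0n.
  by case: h; exists i.
have [wn others] : `|w i0| = 1 /\
    forall i, i \notin chain_set r n -> i != i0 -> w i = 0.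
  have := codeg_rest rP wP; rewrite (bigD1 i0) //=.
  set S := \sum_(i | _) _ => e1.
  have S0 : 0 <= S by apply: sumr_ge0 => i _; apply: exprn_ge0.
  have w1 : 1 <= `|w i0| ^+ 2 by rewrite expr_ge1 ?w_ge1.
  have S00 : S = 0.
    by apply/eqP; rewrite eq_le S0 andbT -(lerD2l (`|w i0| ^+ 2)) e1 addr0.
  split; first by apply/eqP; rewrite -sqrp_eq1 // -e1 S00 addr0.
  move=> i ic' ii0; apply/eqP; rewrite -normr_eq0 -sqrf_eq0.
  by rewrite (psumr_eq0P (fun i _ => exprn_ge0 2 (normr_ge0 _)) S00) // ic' ii0.
have i0d : fdual i0 = i0.
  apply/eqP/negP => /negP di; have := cv_star wP i0; rewrite others //.
    by move/eqP; rewrite eq_sym conjC_eq0 (negbTE wi0).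
  apply: contra ic => /chain_setP[j jn e0]; apply/chain_setP; exists j => //.
  by rewrite -[i0]fdualK e0 (gc_dual rP).
have [eps weps eps1] : exists2 eps : int, w i0 = eps%:~R & eps = 1 \/ eps = -1.
  have wR : (w i0)^* = w i0 by rewrite -(cv_star wP) i0d.
  have : w i0 ^+ 2 == 1 by rewrite expr2 -{2}wR -normCK wn expr1n.
  rewrite sqrf_eq1 => /orP[]/eqP->; first by exists 1 => //; left.
  by exists (-1); [rewrite rmorphN1|right].
pose s : R := \sum_(j < n.+1) b (r j) *+ d j.
pose W : R := s + b i0 *~ eps.
have bs i : bcoef s i = \sum_(j < n.+1) (i == r j)%:R * (d j)%:R.
  rewrite bcoef_bigsum; apply: eq_bigr => j _.
  by rewrite bcoefMn bcoef_basis [RHS]mulr_natr.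
have bs0 i : i \notin chain_set r n -> bcoef s i = 0.
  move=> icn; rewrite bs big1 // => j _; case: eqP => [e0|_]; last by rewrite mul0r.
  by case/chain_setP: icn; exists j; rewrite // -ltnS.
have WE : cinj C W = w.
  apply/ffunP => i; rewrite ffunE bcoefD bcoefMz bcoef_basis.
  case: (boolP (i \in chain_set r n)) => [/[dup] ir /chain_setP[k kn ik]|icn].
    have -> : (i == i0) = false.
      by apply: contraNF ic => /eqP <-.
    rewrite mul0r addr0 bs (bigD1 (Ordinal (kn : (k < n.+1)%N))) //= ik eqxx mul1r.
    rewrite big1 ?addr0 ?(cv_chain wP) ?rmorph_nat // => j jk.
    case: eqP => [/(gc_inj rP) e0|_]; last by rewrite mul0r.
    case/eqP: jk; apply: val_inj; rewrite /= e0 // inE //.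
    by rewrite -ltnS.
  rewrite bs0 // add0r; case: (eqVneq i i0) => [->|ii0]; first by rewrite mul1r.
  by rewrite mul0r others.
have Wi i (c : int) : w i = c%:~R -> b i * W = W *~ c.
  move=> wi; apply: (@cinj_inj C).
  by rewrite rmorphM rmorphMz /= WE (codeg_basis wP) wi rmorph_int scaler_int.
have WC i : W * b i = b i * W.
  by apply: (@cinj_inj C); rewrite !rmorphM /= WE (cv_central wP).
have [as1 as2] := chain_absorb_sum ic; rewrite -/s in as1 as2.
have N0 : (0 < N)%N := greedy_dim_gt0 _.
have NP (x : R) : x *+ N = x *+ N.-1 + x by rewrite -{1}(prednK N0) mulrSr.
(* For the sign +1 the equation puts the coefficient 1 - N on [b i0], which is
   nonnegative only when N = 1; then both signs give the same square. *)
have i0sq : b i0 * b i0 = b i0 *+ N.-1 + s.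
  have := Wi i0 eps weps; rewrite /W mulrDr as1 mulrzAr.
  case: eps1 => ->; rewrite ?mulr1z ?mulrN1z.
    move=> h; have /(congr1 (fun x => bcoef x i0)) := h.
    rewrite !bcoefD bs0 // add0r bcoefMn bcoef_basis eqxx -[true%:R]/(1 : int) [1 *+ N]natz.
    move=> e1; have N1 : N = 1%N.
      have : N%:Z <= 1 by rewrite -e1 lerDl; apply: scoef_ge0.
      by lia.
    by move: h; rewrite N1 mulr1n mulr0n add0r addrC => /addIr.
  rewrite opprB => h; rewrite -[LHS](subKr (b i0 *+ N)) h NP opprB.
  by rewrite addrA addrAC addrK.
apply: (greedy_chain_extend rP ic i0d i0sq) => i icn ii0.
have [ai1 ai2] := chain_absorb_sum icn; rewrite -/s in ai1 ai2.
have z1 : b i * W = 0 by rewrite (Wi i 0) ?mulr0z // others.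
have z2 : W * b i = 0 by rewrite WC.
(* For the sign +1 a nonzero sum of nonnegative combinations would vanish, so no
   such [i] exists; the sign -1 gives the absorption. *)
move: z1 z2; rewrite /W mulrDr mulrDl ai1 ai2 mulrzAr mulrzAl.
case: eps1 => ->; rewrite ?mulr1z ?mulrN1z.
  move=> /(congr1 (fun x => bcoef x i)).
  rewrite bcoefD bcoefMn bcoef_basis eqxx -[true%:R]/(1 : int) [1 *+ N]natz bcoef0.
  move=> e1; have : N%:Z <= 0 by rewrite -e1 lerDl; apply: scoef_ge0.
  by lia.
by move=> /subr0_eq<- /subr0_eq<-.
Qed.

(** The coefficient of 1 in the Casimir element is the rank, so the basis is
    1 and one further element, whose square is 2 - 1. *)
Lemma chain_step_exceptional : N = 1%N -> casimir R = 2%:R ->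
  exists r' : nat -> I, greedy_chain n.+1 r'.
Proof.
move=> N1 z2.
have n0 : n = 0%N.
  case: (n) N1 => // n' e1.
  by have := @greedy_dim_ltn 1 n'.+2 isT; rewrite e1.
have card : #|I| = 2%N.
  have := congr1 (fun x : R => bcoef x (fone R)) z2.
  rewrite bcoef_bigsum bcoefMn bcoef1 eqxx.
  under eq_bigr do rewrite -/(scoef _ _ _) scoef1 eqxx.
  by rewrite sumr_const => /eqP; rewrite eqr_nat => /eqP.
have [i0 i01 all] : exists2 i0, i0 != fone R & forall i, i != fone R -> i = i0.
  have : #|[set~ fone R]| = 1%N by rewrite cardsC1 card.
  move/eqP/cards1P => [i0 h]; exists i0.
    by have := set11 i0; rewrite -h !inE.
  by move=> i i1; apply/set1P; rewrite -h !inE.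
have i0d : fdual i0 = i0.
  by apply: all; rewrite -(fdual1 R) (inj_eq (@fdual_inj R)).
have cs i : (i \in chain_set r n) = (i == fone R).
  apply/chain_setP/eqP => [[j]|->].
    by rewrite n0 leqn0 => /eqP-> ->; rewrite (gc_one rP).
  by exists 0%N; rewrite ?(gc_one rP).
apply: (@greedy_chain_extend _ _ _ rP i0) => //.
- by rewrite cs.
- rewrite N1 mulr0n add0r.
  have -> : \sum_(j < n.+1) b (r j) *+ d j = 1.
    by rewrite n0 big_ord1 (gc_one rP) fbasis1.
  move: z2; rewrite /casimir (bigD1 (fone R)) //= (bigD1 i0) //= big1 ?addr0 => [|i].
    by rewrite fdual1 i0d fbasis1 mul1r mulr2n => /addrI.
  by case/andP => /all->; rewrite eqxx.
- by move=> i; rewrite cs => /all->; rewrite eqxx.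
Qed.

Lemma chain_step : exists r' : nat -> I, greedy_chain n.+1 r'.
Proof.
have [[]|] := pselect (N = 1%N /\ casimir R = 2%:R).
  exact: chain_step_exceptional.
exact: chain_step_generic.
Qed.

End ChainStep.

(** * The fusion subring spanned by a greedy chain *)

Section Assembly.

Lemma greedy_chain0 (R : fusionRing) : greedy_chain 0 (fun _ => fone R).
Proof.
split=> // [j k|k _|k i].
- by rewrite !inE !leqn0 => /eqP-> /eqP->.
- exact: fdual1.
- by rewrite leqn0 => /eqP-> _; rewrite fbasis1 mul1r mulr1.
Qed.

Lemma greedy_chain_exists (K : realType) (R : fusionRing) (n : nat) :
  (forall k, (k < n)%N -> formal_codegree R ((sylvester k)%:R : complex K)) ->
  exists r : nat -> fidx R, greedy_chain n r.
Proof.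
elim: n => [_|n IH codeg]; first by exists (fun=> fone R); apply: greedy_chain0.
have [r rP] := IH (fun k kn => codeg k (leqW kn)).
have [m [phi [[m0 irr] f_codeg]]] := codeg n (ltnSn n).
rewrite /formal_codegree_of /sylvester -greedy_dimS in f_codeg.
have [w wP] := codeg_vector_of_rep rP f_codeg m0 irr.
exact (chain_step rP wP).
Qed.

Lemma fusion_isomorphic_of_scoef (R S : fusionRing) (s : fidx R -> fidx S) :
  bijective s -> s (fone R) = fone S ->
  (forall j k l, scoef (s j) (s k) (s l) = scoef j k l) -> fusion_isomorphic R S.
Proof.
move=> sB s1 sM; have [t st ts] := sB.
pose f (x : R) : S := \sum_i fbasis (s i) *~ bcoef x i.
have fc x i : bcoef (f x) (s i) = bcoef x i.
  rewrite /f (reindex t) /=; last by exists s => i' _; rewrite ?st ?ts.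
  under eq_bigr do rewrite ts.
  by rewrite (bcoef_sum (fun i => bcoef x (t i))) st.
have f_inj (x : S) (y : R) : (forall i, bcoef x (s i) = bcoef y i) -> f y = x.
  by move=> h; apply: bcoef_inj => i; rewrite -(ts i) fc h.
have fB : zmod_morphism f.
  by move=> x y; apply: f_inj => i; rewrite !bcoefB !fc.
have fM : monoid_morphism f.
  split=> [|x y]; apply: f_inj => i.
    by rewrite !bcoef1 -s1 (bij_eq sB).
  rewrite !bcoefM (reindex s) /=; last by apply: onW_bij.
  apply: eq_bigr => j _; rewrite (reindex s) /=; last by apply: onW_bij.
  by apply: eq_bigr => k _; rewrite !fc sM.
pose f1 := GRing.isZmodMorphism.Build R S f fB.
pose f2 := GRing.isMonoidMorphism.Build R S f fM.
pose F : {rmorphism R -> S} := HB.pack f f1 f2.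
exists F; split; last first.
  exists s; split=> // i; apply: f_inj => j.
  by rewrite !bcoef_basis (bij_eq sB).
exists (fun y : S => \sum_i fbasis i *~ bcoef y (s i)) => [x|y] /=.
  by rewrite [RHS]bcoefE; apply: eq_bigr => i _; rewrite fc.
by apply: f_inj => i; rewrite bcoef_sum.
Qed.

Variables (R : fusionRing) (n : nat) (r : nat -> fidx R).
Hypothesis rP : greedy_chain n r.
Local Notation b := (@fbasis R).

Lemma chain_mul j k : (j <= n)%N -> (k <= n)%N ->
  b (r j) * b (r k) = \sum_(l < n.+1) b (r l) *+ greedy_coef j k l.
Proof.
move=> jn kn.
have pick c i : (i <= n)%N ->
    \sum_(l < n.+1) b (r l) *+ (c * (l == i :> nat)) = b (r i) *+ c.
  move=> ni; rewrite (bigD1 (Ordinal (ni : (i < n.+1)%N))) //= eqxx muln1.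
  rewrite big1 ?addr0 // => l li; rewrite (negbTE (li : val l != i)) muln0.
  by rewrite mulr0n.
rewrite /greedy_coef; case: (ltngtP j k) => [jk|kj|<-].
- rewrite pick //; apply: (gc_absorb rP jn _).2.
  by rewrite (mem_chain_set rP) // -ltnNge.
- rewrite pick //; apply: (gc_absorb rP kn _).1.
  by rewrite (mem_chain_set rP) // -ltnNge.
case: j jn => [|j] jn.
  rewrite (gc_one rP) fbasis1 mul1r; have := pick 1%N 0%N isT.
  by under eq_bigr do rewrite mul1n; rewrite (gc_one rP) fbasis1 => ->.
under eq_bigr do rewrite mulrnDr.
rewrite big_split /= pick // (gc_sq rP jn); congr (_ *+ _ + _).
  by rewrite /greedy_dim -subn1 -subnDA.
rewrite (big_ord_widen n.+1 (fun l => b (r l) *+ greedy_dim l)) 1?ltnW //.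
by rewrite big_mkcond; apply: eq_bigr => l _; case: ifP; rewrite ?mulr0n.
Qed.

Lemma chain_subring_closed :
  {in fspan (chain_set r n) &, forall x y : R, x * y \in fspan (chain_set r n)}.
Proof.
move=> x y /fspanP hx /fspanP hy; apply/fspanP => i ic; rewrite -/(bcoef _ _).
rewrite bcoefM big1 // => j _; rewrite big1 // => k _.
case: (boolP (j \in chain_set r n)) => [|/hx]; last by rewrite /bcoef => ->; rewrite !mul0r.
case: (boolP (k \in chain_set r n)) => [|/hy]; last first.
  by rewrite /bcoef => -> _; rewrite mulr0 mul0r.
move=> /chain_setP[k' kn ->] /chain_setP[j' jn ->].
rewrite /scoef chain_mul // bcoef_bigsum big1 ?mulr0 // => l _.
rewrite bcoefMn bcoef_basis; case: eqP => [il|]; last by rewrite mul0rn.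
by case/chain_setP: ic; exists l; rewrite // -ltnS.
Qed.

Lemma chain_fusionSubring : exists S : fusionSubring R,
  fusion_isomorphic (fusion_of_subring S) (greedy_fusion n).
Proof.
have one : fone R \in chain_set r n.
  by apply/chain_setP; exists 0%N; rewrite ?(gc_one rP).
have dual : {in chain_set r n, forall i, fdual i \in chain_set r n}.
  move=> i /chain_setP[k kn ->]; rewrite (gc_dual rP kn).
  by apply/chain_setP; exists k.
pose S := FusionSubring one chain_subring_closed dual.
exists S.
have idx (i : fidx (fusion_of_subring S)) : exists j : 'I_n.+1, val i = r j.
  case: i => i /= /chain_setP[j jn ->].
  by exists (Ordinal (jn : (j < n.+1)%N)).
have [s sE] := fin_all_exists idx.
have rI (i j : 'I_n.+1) : r i = r j -> i = j.
  by move/(gc_inj rP) => e; apply: val_inj; apply: e; rewrite inE -ltnS.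
apply: (@fusion_isomorphic_of_scoef (fusion_of_subring S) (greedy_fusion n) s).
- have rin (j : 'I_n.+1) : r j \in fsub_set S.
    by apply/chain_setP; exists j; rewrite // -ltnS.
  exists (fun j : 'I_n.+1 => exist _ (r j) (rin j) : fidx (fusion_of_subring S)).
    by move=> i; apply: val_inj; rewrite /= -sE.
  by move=> j; apply: rI; rewrite -sE.
- by apply: rI; rewrite -sE /= (gc_one rP).
move=> j k l.
have -> : @scoef (greedy_fusion n) (s j) (s k) (s l) = (greedy_coef (s j) (s k) (s l))%:Z.
  by rewrite /scoef /bcoef /= greedy_basisM greedy_Zcoord greedy_sumE ffunE.
have sn i : (s i <= n)%N by rewrite -ltnS.
rewrite /scoef [RHS]fsub_coord /= -/(bcoef _ _) !sE chain_mul // bcoef_bigsum.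
rewrite (bigD1 (s l)) //= bcoefMn bcoef_basis eqxx big1 ?addr0 => [|i il].
  by rewrite -[true%:R]/(1 : int) natz.
rewrite bcoefMn bcoef_basis; case: eqP => [/rI e|]; last by rewrite mul0rn.
by rewrite e eqxx in il.
Qed.

End Assembly.

Theorem proposition1 (K : realType) (R : fusionRing) (n : nat) (n_ge1 : (1 <= n)%N)
    (codeg : forall k : nat, (k < n)%N -> formal_codegree R ((sylvester k)%:R : complex K)) :
  exists S : fusionSubring R,
    fusion_isomorphic (fusion_of_subring S) (greedy_fusion n).
Proof.
have [r rP] := greedy_chain_exists codeg.
exact: chain_fusionSubring rP.
Qed.
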